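(* Let $(M,F)$ be a Finsler manifold admitting a concurrent $\pi$-vector field $\overline{\varphi}$ with associated $\pi$-form $\phi=i_{\overline{\varphi}}g$; put $\Phi=\phi(\overline{\eta})$ and $p^2=g(\overline\varphi,\overline\varphi)$. Let $\widehat F=\frac{F^2}{F-\Phi}$ on $\mathcal D=\{(x,y)\in TM : F(x,y)>\Phi(x,y)\}$ be a generalized $\phi$-Matsumoto metric (i.e. a conic pseudo-Finsler structure), with $F(1+2p^2)-3\Phi\ne0$ on $\mathcal D$. Then the geodesic sprays $G$ of $F$ and $\widehat G$ of $\widehat F$ can never be projectively related.
   Context: Projectively related: $G$ and $\widehat G$ (equivalently $F$ and $\widehat F$) are projectively related if $\widehat G=G-2A\,\mathcal C$ for some function $A(x,y)$ positively homogeneous of degree $1$ in $y$ (on the common domain $\mathcal D$). Setting. $M$ is an $n$-dimensional paracompact smooth manifold, $\pi:TM\to M$ its tangent bundle, $\mathcal TM=TM\setminus\{0\}$ the slit tangent bundle. $\pi$-vector fields are smooth sections of the pullback of the bundle $TM\to M$ over $\mathcal TM$ (local basis $\overline{\partial}_i$); $\pi$-forms/tensors are the corresponding (dual) tensor sections. $\gamma$ is the natural injection (vertical lift) $\gamma(W^i\overline\partial_i)=W^i\partial_{y^i}$, $\rho(a^i\partial_{x^i}+b^i\partial_{y^i})=a^i\overline\partial_i$, $J=\gamma\circ\rho$, $\overline\eta(u)=(u,u)$ (i.e. $\overline\eta=y^i\overline\partial_i$), $\mathcal C=\gamma\overline\eta$ is the Liouville field, and $d_Jf=df\circ J$ for functions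 $f$. Finsler structure: $F:TM\to[0,\infty)$, $C^\infty$ on $\mathcal TM$, $C^0$ on $TM$, positively homogeneous of degree 1 in $y$, with $dd_JE$ of maximal rank, $E=\frac12F^2$. Metric tensor: $g(\rho W,\rho Z)=dd_JE(JW,Z)$ (it is positive definite). Geodesic spray $G$: the vector field with $JG=\mathcal C$, $[\mathcal C,G]=G$, $i_Gdd_JE=-dE$. Barthel connection $\Gamma=[J,G]$ (i.e. $\Gamma X=[JX,G]-J[X,G]$), projectors $h=\frac12(I+\Gamma)$, $v=\frac12(I-\Gamma)$, horizontal map $\beta=(\rho|_{\mathrm{Im}\,h})^{-1}$. Berwald connection $D^\circ$: $\gamma D^\circ_{hZ}\rho W=v[hZ,JW]$, $D^\circ_{\gamma\overline Z}\overline W=\rho[\gamma\overline Z,\beta\overline W]$. Cartan connection $\nabla$: determined by $2g(\nabla_{\gamma\overline X}\overline Y,\overline Z)=\gamma\overline X\cdot g(\overline Y,\overline Z)+g(\overline Y,\rho[\beta\overline Z,\gamma\overline X])+g(\overline Z,\rho[\gamma\overline X,\beta\overline Y])$ and $2g(\nabla_{\beta\overline X}\overline Y,\overline Z)=\beta\overline X\cdot g(\overline Y,\overline Z)+\beta\overline Y\cdot g(\overline Z,\overline X)-\beta\overline Z\cdot g(\overline X,\overline Y)-g(\overline X,\rho[\beta\overline Y,\beta\overline Z])+g(\overline Y,\rho[\beta\overline Z,\beta\overline X])+g(\overline Z,\rho[\beta\overline X,\beta\overline Y])$. Concurrent $\pi$-vector field: a non-vanishing (everywhere nonzero) $\pi$-vector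 field $\overline\varphi$ with $\nabla_{\beta\overline W}\overline\varphi=-\overline W=D^\circ_{\beta\overline W}\overline\varphi$ and $\nabla_{\gamma\overline W}\overline\varphi=0=D^\circ_{\gamma\overline W}\overline\varphi$ for all $\overline W$. Conic pseudo-Finsler structure on $M$: a smooth function to $[0,\infty)$ on a conic sub-bundle $\mathcal D\subset\mathcal TM$ (non-empty, open, invariant under scaling by positive reals, $\pi(\mathcal D)=M$, each fibre $\mathcal D_x$ connected), positively 1-homogeneous in $y$, whose form $dd_J(\frac12(\cdot)^2)$ has maximal rank. For the conic pseudo-Finsler structure $\widehat F$, the energy $\widehat E=\frac12\widehat F^2$, metric tensor $\widehat g$, geodesic spray $\widehat G$, Barthel connection $\widehat\Gamma$, projectors $\widehat h,\widehat v$, horizontal map $\widehat\beta$, Berwald connection $\widehat D^\circ$ and Cartan connection $\widehat\nabla$ are defined on $\mathcal D$ by the same formulas as the corresponding unhatted objects of $F$.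
   Formalization: The dimension n of M is required to be at least 2; for n = 1 any two sprays are projectively related while the hypotheses can hold (M = (1,∞), F = |y|, φ = −x∂_x, D = {y > 0}), so the claim is false there. *)

(* Defs.v *)
From mathcomp Require Import all_boot all_order all_algebra.
From mathcomp Require Import all_classical all_reals all_analysis.

Set Implicit Arguments.
Unset Strict Implicit.
Unset Printing Implicit Defensive.

Import Order.TTheory GRing.Theory Num.Theory.
Import numFieldNormedType.Exports.

Local Open Scope classical_set_scope.
Local Open Scope ring_scope.

(** * Smooth manifolds *)

Fixpoint times_differentiable (R : realType) (m : nat) (V : normedModType R)
    (k : nat) (O : set 'rV[R]_m) (f : 'rV[R]_m -> V) : Prop :=
  match k with
  | 0 => True
  | k'.+1 => (forall x, O x -> differentiable f x) /\
             (forall v, times_differentiable k' O ('D_v f))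
  end.

(* C^infinity on [O]; only used for [O] open. *)
Definition smooth (R : realType) (m : nat) (V : normedModType R)
    (O : set 'rV[R]_m) (f : 'rV[R]_m -> V) : Prop :=
  forall k, times_differentiable k O f.

Definition paracompact (T : topologicalType) : Prop :=
  forall (I : Type) (U : I -> set T),
    (forall i, open (U i)) -> \bigcup_i U i = setT ->
    exists (K : Type) (V : K -> set T),
      [/\ forall k, open (V k), \bigcup_k V k = setT,
          forall k, exists i, V k `<=` U i &
          forall x : T, exists2 N, nbhs x N &
            finite_set [set k | V k `&` N !=set0]].

(* [crd a] is only meaningful on [dom a], and [pnt a] only on its image. *)
Record atlas (R : realType) (n : nat) (M : topologicalType) := Atlas {
  idx : Type;
  dom : idx -> set M;
  crd : idx -> M -> 'rV[R]_n;
  pnt : idx -> 'rV[R]_n -> M;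
  dom_open : forall a, open (dom a);
  dom_cover : forall p, exists a, dom a p;
  img_open : forall a, open (crd a @` dom a);
  crdK : forall a p, dom a p -> pnt a (crd a p) = p;
  crd_continuous : forall a p, dom a p -> {for p, continuous (crd a)};
  pnt_continuous : forall a x, (crd a @` dom a) x -> {for x, continuous (pnt a)};
  trans_smooth : forall a b,
    smooth (crd a @` (dom a `&` dom b)) (crd b \o pnt a) }.

(** * Objects on the tangent bundle

  Over the domain of the chart [a], a point of TM is given by its natural
  coordinates [z = (x, y)] (a row of size n + n), where x lies in [img a] and
  y is the row of components of the tangent vector; a tangent vector to TM is
  given by its components in the basis d/dx^i, d/dy^i, and a pi-vector by its
  components in the basis dbar_i.  A subset of TM, a function, a vector field,
  a pi-vector field on a part of TM are the families of their coordinate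
  expressions, subject to the usual transformation laws. *)

Definition img (R : realType) (n : nat) (M : topologicalType)
    (A : atlas R n M) (a : idx A) : set 'rV[R]_n := crd a @` dom a.

Definition overlap (R : realType) (n : nat) (M : topologicalType)
    (A : atlas R n M) (a b : idx A) : set 'rV[R]_n :=
  crd a @` (dom a `&` dom b).

Definition trans (R : realType) (n : nat) (M : topologicalType)
    (A : atlas R n M) (a b : idx A) : 'rV[R]_n -> 'rV[R]_n := crd b \o pnt a.

Definition tm_trans (R : realType) (n : nat) (M : topologicalType)
    (A : atlas R n M) (a b : idx A) (z : 'rV[R]_(n + n)) : 'rV[R]_(n + n) :=
  row_mx (trans a b (lsubmx z)) ('D_(rsubmx z) (trans a b) (lsubmx z)).

Definition tm_set (R : realType) (n : nat) (M : topologicalType)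
    (A : atlas R n M) (D : idx A -> set 'rV[R]_(n + n)) : Prop :=
  (forall a z, D a z -> img a (lsubmx z)) /\
  (forall a b z, overlap a b (lsubmx z) -> (D a z <-> D b (tm_trans a b z))).

Definition tm_function (R : realType) (n : nat) (M : topologicalType)
    (A : atlas R n M) (D : idx A -> set 'rV[R]_(n + n))
    (f : idx A -> 'rV[R]_(n + n) -> R) : Prop :=
  forall a b z, overlap a b (lsubmx z) -> D a z ->
    f b (tm_trans a b z) = f a z.

Definition tm_vector_field (R : realType) (n : nat) (M : topologicalType)
    (A : atlas R n M) (D : idx A -> set 'rV[R]_(n + n))
    (X : idx A -> 'rV[R]_(n + n) -> 'rV[R]_(n + n)) : Prop :=
  (forall a, smooth (D a) (X a)) /\
  (forall a b z, overlap a b (lsubmx z) -> D a z ->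
    X b (tm_trans a b z) = 'D_(X a z) (tm_trans a b) z).

Definition pi_vector_field (R : realType) (n : nat) (M : topologicalType)
    (A : atlas R n M) (D : idx A -> set 'rV[R]_(n + n))
    (W : idx A -> 'rV[R]_(n + n) -> 'rV[R]_n) : Prop :=
  (forall a, smooth (D a) (W a)) /\
  (forall a b z, overlap a b (lsubmx z) -> D a z ->
    W b (tm_trans a b z) = 'D_(W a z) (trans a b) (lsubmx z)).

Definition tangent_bundle (R : realType) (n : nat) (M : topologicalType)
    (A : atlas R n M) (a : idx A) : set 'rV[R]_(n + n) :=
  [set z | img a (lsubmx z)].

Definition slit_bundle (R : realType) (n : nat) (M : topologicalType)
    (A : atlas R n M) (a : idx A) : set 'rV[R]_(n + n) :=
  [set z | img a (lsubmx z) /\ rsubmx z != 0].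

Definition fib_scale (R : realType) (n : nat) (t : R) (z : 'rV[R]_(n + n)) :
    'rV[R]_(n + n) := row_mx (lsubmx z) (t *: rsubmx z).

Definition pos_homogeneous1 (R : realType) (n : nat) (M : topologicalType)
    (A : atlas R n M) (D : idx A -> set 'rV[R]_(n + n))
    (f : idx A -> 'rV[R]_(n + n) -> R) : Prop :=
  forall a z t, D a z -> 0 < t -> f a (fib_scale t z) = t * f a z.

(** * Geometry of TM in natural coordinates *)

Definition rho (R : realType) (n : nat) (X : 'rV[R]_(n + n)) : 'rV[R]_n :=
  lsubmx X.

Definition gamma (R : realType) (n : nat) (w : 'rV[R]_n) : 'rV[R]_(n + n) :=
  row_mx 0 w.

Definition Jend (R : realType) (n : nat) (X : 'rV[R]_(n + n)) :
    'rV[R]_(n + n) := gamma (rho X).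

Definition eta (R : realType) (n : nat) (z : 'rV[R]_(n + n)) : 'rV[R]_n :=
  rsubmx z.

Definition liouville (R : realType) (n : nat) (z : 'rV[R]_(n + n)) :
    'rV[R]_(n + n) := gamma (eta z).

Definition bracket (R : realType) (m : nat) (X Y : 'rV[R]_m -> 'rV[R]_m)
    (z : 'rV[R]_m) : 'rV[R]_m :=
  'D_(X z) Y z - 'D_(Y z) X z.

(* For vector fields with constant components the bracket term of the
   intrinsic formula for d(omega) vanishes. *)
Definition ext_d (R : realType) (m : nat)
    (omega : 'rV[R]_m -> 'rV[R]_m -> R) (z X Y : 'rV[R]_m) : R :=
  'D_X (fun z' => omega z' Y) z - 'D_Y (fun z' => omega z' X) z.

Definition d_J (R : realType) (n : nat) (f : 'rV[R]_(n + n) -> R)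
    (z X : 'rV[R]_(n + n)) : R := 'D_(Jend X) f z.

Definition dd_J (R : realType) (n : nat) (f : 'rV[R]_(n + n) -> R)
    (z X Y : 'rV[R]_(n + n)) : R := ext_d (d_J f) z X Y.

Definition dd_J_rank (R : realType) (n : nat) (f : 'rV[R]_(n + n) -> R)
    (z : 'rV[R]_(n + n)) : nat :=
  \rank (\matrix_(i < n + n, j < n + n)
           dd_J f z (delta_mx 0 i) (delta_mx 0 j)).

Definition energy (R : realType) (n : nat) (F : 'rV[R]_(n + n) -> R)
    (z : 'rV[R]_(n + n)) : R := 2^-1 * F z ^+ 2.

(* [g (rho W, rho Z) = dd_J E (J W, Z)] with [J W = gamma (rho W)] and, for
   [Z], the lift of [v] with zero vertical components; dd_J E vanishes on
   pairs of vertical vectors, so the choice of the lift is immaterial. *)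
Definition metric (R : realType) (n : nat) (F : 'rV[R]_(n + n) -> R)
    (z : 'rV[R]_(n + n)) (u v : 'rV[R]_n) : R :=
  dd_J (energy F) z (gamma u) (row_mx v 0).

(* Gamma is a tensor: it is evaluated on the vector [X] at [z] by extending
   [X] with constant components. *)
Definition barthel (R : realType) (n : nat)
    (G : 'rV[R]_(n + n) -> 'rV[R]_(n + n)) (z X : 'rV[R]_(n + n)) :
    'rV[R]_(n + n) :=
  bracket (fun=> Jend X) G z - Jend (bracket (fun=> X) G z).

Definition hproj (R : realType) (n : nat)
    (G : 'rV[R]_(n + n) -> 'rV[R]_(n + n)) (z X : 'rV[R]_(n + n)) :
    'rV[R]_(n + n) := 2^-1 *: (X + barthel G z X).

Definition vproj (R : realType) (n : nat)
    (G : 'rV[R]_(n + n) -> 'rV[R]_(n + n)) (z X : 'rV[R]_(n + n)) :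
    'rV[R]_(n + n) := 2^-1 *: (X - barthel G z X).

(* The horizontal map: the inverse of the restriction of [rho] to Im h. *)
Definition beta (R : realType) (n : nat)
    (G : 'rV[R]_(n + n) -> 'rV[R]_(n + n)) (z : 'rV[R]_(n + n))
    (w : 'rV[R]_n) : 'rV[R]_(n + n) :=
  xget 0 [set X | range (hproj G z) X /\ rho X = w].

(* [D z X W] is the covariant derivative at [z] of the local pi-vector field
   [W] in the direction of the vector [X] tangent to TM at [z]. *)
Definition connection (R : realType) (n : nat) :=
  'rV[R]_(n + n) -> 'rV[R]_(n + n) -> ('rV[R]_(n + n) -> 'rV[R]_n) -> 'rV[R]_n.

Definition berwald (R : realType) (n : nat) (O : set 'rV[R]_(n + n))
    (G : 'rV[R]_(n + n) -> 'rV[R]_(n + n)) (D : connection R n) : Prop :=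
  forall U : set 'rV[R]_(n + n), open U -> U `<=` O ->
    (forall Z W : 'rV[R]_(n + n) -> 'rV[R]_(n + n), smooth U Z -> smooth U W ->
      forall z, U z ->
      gamma (D z (hproj G z (Z z)) (fun z' => rho (W z'))) =
      vproj G z (bracket (fun z' => hproj G z' (Z z'))
                         (fun z' => Jend (W z')) z)) /\
    (forall Z W : 'rV[R]_(n + n) -> 'rV[R]_n, smooth U Z -> smooth U W ->
      forall z, U z ->
      D z (gamma (Z z)) W =
      rho (bracket (fun z' => gamma (Z z')) (fun z' => beta G z' (W z')) z)).

Definition cartan (R : realType) (n : nat) (O : set 'rV[R]_(n + n))
    (F : 'rV[R]_(n + n) -> R) (G : 'rV[R]_(n + n) -> 'rV[R]_(n + n))
    (D : connection R n) : Prop :=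
  forall U : set 'rV[R]_(n + n), open U -> U `<=` O ->
  forall X Y Z : 'rV[R]_(n + n) -> 'rV[R]_n,
    smooth U X -> smooth U Y -> smooth U Z ->
  let g (V W : 'rV[R]_(n + n) -> 'rV[R]_n) z := metric F z (V z) (W z) in
  let c (W : 'rV[R]_(n + n) -> 'rV[R]_n) z := gamma (W z) in
  let b (W : 'rV[R]_(n + n) -> 'rV[R]_n) z := beta G z (W z) in
  let br (V W : 'rV[R]_(n + n) -> 'rV[R]_(n + n)) z := rho (bracket V W z) in
  forall z, U z ->
    2 * metric F z (D z (c X z) Y) (Z z) =
      'D_(c X z) (g Y Z) z + g Y (br (b Z) (c X)) z + g Z (br (c X) (b Y)) z /\
    2 * metric F z (D z (b X z) Y) (Z z) =
      'D_(b X z) (g Y Z) z + 'D_(b Y z) (g Z X) z - 'D_(b Z z) (g X Y) z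
      - g X (br (b Y) (b Z)) z + g Y (br (b Z) (b X)) z + g Z (br (b X) (b Y)) z.

(** * Finsler structures *)

Definition finsler (R : realType) (n : nat) (M : topologicalType)
    (A : atlas R n M) (F : idx A -> 'rV[R]_(n + n) -> R) : Prop :=
  [/\ tm_function (@tangent_bundle R n M A) F,
      forall a z, tangent_bundle a z -> 0 <= F a z,
      forall a z, tangent_bundle a z -> {for z, continuous (F a)},
      forall a, smooth (slit_bundle a) (F a) &
   [/\ pos_homogeneous1 (@tangent_bundle R n M A) F,
      forall a z, slit_bundle a z -> dd_J_rank (energy (F a)) z = (n + n)%N &
      forall a z u, slit_bundle a z -> u != 0 -> 0 < metric (F a) z u u]].

Definition conic_subbundle (R : realType) (n : nat) (M : topologicalType)
    (A : atlas R n M) (D : idx A -> set 'rV[R]_(n + n)) : Prop :=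
  [/\ tm_set D,
      forall a, D a `<=` slit_bundle a,
      exists a z, D a z,
      forall a, open (D a) &
   [/\ forall a z t, D a z -> 0 < t -> D a (fib_scale t z),
      forall a x, img a x -> exists y, D a (row_mx x y) &
      forall a x, img a x -> connected [set y | D a (row_mx x y)]]].

Definition conic_pseudo_finsler (R : realType) (n : nat) (M : topologicalType)
    (A : atlas R n M) (D : idx A -> set 'rV[R]_(n + n))
    (F : idx A -> 'rV[R]_(n + n) -> R) : Prop :=
  [/\ conic_subbundle D,
      tm_function D F,
      forall a z, D a z -> 0 <= F a z,
      forall a, smooth (D a) (F a) &
   [/\ pos_homogeneous1 D F &
      forall a z, D a z -> dd_J_rank (energy (F a)) z = (n + n)%N]].

Definition geodesic_spray (R : realType) (n : nat) (M : topologicalType)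
    (A : atlas R n M) (D : idx A -> set 'rV[R]_(n + n))
    (F : idx A -> 'rV[R]_(n + n) -> R)
    (G : idx A -> 'rV[R]_(n + n) -> 'rV[R]_(n + n)) : Prop :=
  tm_vector_field D G /\
  forall a z, D a z ->
    [/\ Jend (G a z) = liouville z,
        bracket (@liouville R n) (G a) z = G a z &
        forall Y, dd_J (energy (F a)) z (G a z) Y = - 'D_Y (energy (F a)) z].

(* [nabla] and [Dc] are meant to be the Cartan and Berwald connections of the
   Finsler structure with geodesic spray [G]. *)
Definition concurrent (R : realType) (n : nat) (M : topologicalType)
    (A : atlas R n M) (G : idx A -> 'rV[R]_(n + n) -> 'rV[R]_(n + n))
    (nabla Dc : idx A -> connection R n)
    (phi : idx A -> 'rV[R]_(n + n) -> 'rV[R]_n) : Prop :=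
  [/\ pi_vector_field (@slit_bundle R n M A) phi,
      forall a z, slit_bundle a z -> phi a z != 0 &
      forall a z w, slit_bundle a z ->
        [/\ nabla a z (beta (G a) z w) (phi a) = - w,
            Dc a z (beta (G a) z w) (phi a) = - w,
            nabla a z (gamma w) (phi a) = 0 &
            Dc a z (gamma w) (phi a) = 0]].

Definition projectively_related (R : realType) (n : nat) (M : topologicalType)
    (A : atlas R n M) (D : idx A -> set 'rV[R]_(n + n))
    (G Gh : idx A -> 'rV[R]_(n + n) -> 'rV[R]_(n + n)) : Prop :=
  exists P : idx A -> 'rV[R]_(n + n) -> R,
    [/\ tm_function D P, pos_homogeneous1 D P &
        forall a z, D a z -> Gh a z = G a z - (2 * P a z) *: liouville z].

(** * The phi-Matsumoto metric *)

Definition phi_form (R : realType) (n : nat) (M : topologicalType)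
    (A : atlas R n M) (F : idx A -> 'rV[R]_(n + n) -> R)
    (phi : idx A -> 'rV[R]_(n + n) -> 'rV[R]_n)
    (a : idx A) (z : 'rV[R]_(n + n)) (w : 'rV[R]_n) : R :=
  metric (F a) z (phi a z) w.

Definition Phi (R : realType) (n : nat) (M : topologicalType)
    (A : atlas R n M) (F : idx A -> 'rV[R]_(n + n) -> R)
    (phi : idx A -> 'rV[R]_(n + n) -> 'rV[R]_n)
    (a : idx A) (z : 'rV[R]_(n + n)) : R := phi_form F phi a z (eta z).

Definition p2 (R : realType) (n : nat) (M : topologicalType)
    (A : atlas R n M) (F : idx A -> 'rV[R]_(n + n) -> R)
    (phi : idx A -> 'rV[R]_(n + n) -> 'rV[R]_n)
    (a : idx A) (z : 'rV[R]_(n + n)) : R :=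
  metric (F a) z (phi a z) (phi a z).

(* [Phi] is only defined on the slit bundle; on the zero section F vanishes
   and so would [Phi], hence no point of it satisfies F > Phi. *)
Definition matsumoto_domain (R : realType) (n : nat) (M : topologicalType)
    (A : atlas R n M) (F : idx A -> 'rV[R]_(n + n) -> R)
    (phi : idx A -> 'rV[R]_(n + n) -> 'rV[R]_n)
    (a : idx A) : set 'rV[R]_(n + n) :=
  [set z | slit_bundle a z /\ Phi F phi a z < F a z].

Definition matsumoto (R : realType) (n : nat) (M : topologicalType)
    (A : atlas R n M) (F : idx A -> 'rV[R]_(n + n) -> R)
    (phi : idx A -> 'rV[R]_(n + n) -> 'rV[R]_n)
    (a : idx A) (z : 'rV[R]_(n + n)) : R :=
  F a z ^+ 2 / (F a z - Phi F phi a z).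

(* Main.v *)
(** Everything takes place in one chart, on the open set where F > Phi, with the
  vector fields G, V = gamma phi, C (Liouville) and H = beta phi acting as
  derivations.  The Berwald half of the concurrence condition amounts to
  [V,G] = H + C, [H,V] = -V and [C,V] = -V; since moreover GE = HE = 0 and
  CE = 2E, the function Phi = VE satisfies G Phi = -F^2, H Phi = -Phi,
  C Phi = Phi, and G(p^2) = -2 Phi.  If a 1-homogeneous L has a spray projectively
  related to G, its Euler-Lagrange equation in the direction phi reads
  G V L = H L - L.  For L = F^2/(F - Phi) this becomes Phi^2 = F^2 p^2, the
  equality case of the Cauchy-Schwarz inequality, so that F^2 phi = Phi y on an
  open set of directions y.  But phi does not depend on y, which is impossible in
  dimension at least 2. *)

Require Import Defs.
From mathcomp Require Import all_boot all_order all_algebra.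
From mathcomp Require Import all_classical all_reals all_analysis.
From mathcomp Require Import ring lra.
Set Implicit Arguments.
Unset Strict Implicit.
Unset Printing Implicit Defensive.
Import Order.TTheory GRing.Theory Num.Theory.
Import numFieldNormedType.Exports.
Local Open Scope classical_set_scope.
Local Open Scope ring_scope.

(** * Symmetry of second derivatives *)

Lemma derive_dirD (R : realType) (V W : normedModType R) (f : V -> W) z u v :
  differentiable f z -> 'D_(u + v) f z = 'D_u f z + 'D_v f z.
Proof. by move=> df; rewrite !deriveE// linearD. Qed.

Lemma derive_dirN (R : realType) (V W : normedModType R) (f : V -> W) z v :
  differentiable f z -> 'D_(- v) f z = - 'D_v f z.
Proof. by move=> df; rewrite !deriveE// linearN. Qed.

Lemma derive_dirB (R : realType) (V W : normedModType R) (f : V -> W) z u v :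
  differentiable f z -> 'D_(u - v) f z = 'D_u f z - 'D_v f z.
Proof. by move=> df; rewrite !deriveE// linearB. Qed.

Lemma derive_dirZ (R : realType) (V W : normedModType R) (f : V -> W) z c v :
  differentiable f z -> 'D_(c *: v) f z = c *: 'D_v f z.
Proof. by move=> df; rewrite !deriveE// linearZ. Qed.

Lemma derive_dir_sum (R : realType) (m : nat) (W : normedModType R)
    (f : 'rV[R]_m -> W) z v : differentiable f z ->
  'D_v f z = \sum_(i < m) v 0 i *: 'D_(delta_mx 0 i) f z.
Proof.
move=> df; rewrite deriveE// {1}(row_sum_delta v) linear_sum/=.
by apply: eq_bigr => i _; rewrite linearZ/= deriveE.
Qed.

Lemma is_derive_line (R : realType) (V W : normedModType R) (f : V -> W)
    (x w : V) (t : R) : differentiable f (x + t *: w) ->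
  is_derive t 1 (fun s => f (x + s *: w)) ('D_w f (x + t *: w)).
Proof.
move=> df.
have hg : is_diff t (fun s : R => x + s *: w) ( *:%R ^~ w).
  have -> : (fun s : R => x + s *: w) = cst x + ( *:%R ^~ w) by [].
  by apply: is_diff_eq; rewrite add0r.
have hdf : is_diff (x + t *: w) f ('d f (x + t *: w)) by exact: DiffDef.
have := @is_diff_comp _ _ _ _ _ _ _ _ t hg hdf.
move=> [dfg dE]; apply: DeriveDef; first exact: diff_derivable.
by rewrite deriveE// dE/= scale1r deriveE.
Qed.

(** [A] and [B] stand for values of a first derivative at two nearby points, and [h * d1] is the
    difference of their linear parts. The shared part [g + d0] cancels on subtraction, and dividing
    by [h] turns the total error [e / K * (n1 + n0)] into at most [e]. *)
Lemma second_difference_estimate (R : realType)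
    (A B g d0 d1 e h K n0 n1 : R) : 0 < K -> h != 0 ->
  `|A - (g + (d0 + h * d1))| <= e / K * n1 -> `|B - (g + d0)| <= e / K * n0 ->
  n1 + n0 <= `|h| * K -> 0 < e ->
  `|d1 - h ^- 2 * (h *: (A : R^o) - h *: (B : R^o))| <= e.
Proof.
move=> K0 h0 lA lB n10 e0.
have hh : 0 < `|h| by rewrite normr_gt0.
have -> : d1 - h ^- 2 * (h *: (A : R^o) - h *: (B : R^o)) =
   - h^-1 * ((A - (g + (d0 + h * d1))) - (B - (g + d0))).
  by rewrite /GRing.scale/=; field.
rewrite normrM normrN normfV [X in X <= _]mulrC ler_pdivrMr//.
apply: le_trans (ler_normB _ _) _; apply: le_trans (lerD lA lB) _.
by rewrite -mulrDr mulrAC ler_pdivrMr// -mulrA ler_pM2l// mulrC.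
Qed.

(* The mean value theorem in the direction [u] reduces the second difference
   quotient to a difference of ['D_u f], which is differentiable at [z]. *)
Lemma second_difference_cvg (R : realType) (V : normedModType R) (f : V -> R)
    (z u v : V) : (\forall x \near z, differentiable f x) ->
  differentiable ('D_u f) z ->
  h ^- 2 * (f (z + h *: u + h *: v) - f (z + h *: u) - f (z + h *: v) + f z)
    @[h --> 0^'] --> 'D_v ('D_u f) z.
Proof.
move=> fd dg; set g := 'D_u f in dg *.
apply/cvgrPdist_le => e e0.
(* |h| K bounds the sum of the norms of the two displacements at which [g] will be linearised; the
   summand 1 secures [0 < K]. *)
set K := 1 + 2 * `|u| + `|v|.
have K0 : 0 < K by rewrite /K; have := normr_ge0 u; have := normr_ge0 v; lra.
have /eqaddoP/(_ (e / K)) := @diff_locally _ _ _ z g dg.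
rewrite divr_gt0// => /(_ isT) /nbhs_ballP[r1/= r10 lin].
move: fd => /nbhs_ballP[r2/= r20 fd].
pose r := Num.min r1 r2.
have r0 : 0 < r by rewrite lt_min r10.
near=> h.
have h0 : h != 0 by near: h; exact: nbhs_dnbhs_neq.
have hr : `|h| < r / K by near: h; apply: dnbhs0_lt; rewrite divr_gt0.
have hK : `|h| * K < r by rewrite -ltr_pdivlMr.
have small (s t : R) : 0 <= s <= 1 -> 0 <= t <= 1 ->
    `|(s * h) *: u + (t * h) *: v| < r.
  move=> /andP[s0 s1] /andP[t0 t1]; apply: le_lt_trans hK.
  rewrite (le_trans (ler_normD _ _))// !normrZ (ger0_norm s0) (ger0_norm t0).
  have := normr_ge0 u; have := normr_ge0 v; have := normr_ge0 h => h1 v1 u1.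
  have : s * (`|h| * `|u|) <= 1 * (`|h| * `|u|)
    by apply: ler_wpM2r => //; exact: mulr_ge0.
  have : t * (`|h| * `|v|) <= 1 * (`|h| * `|v|)
    by apply: ler_wpM2r => //; exact: mulr_ge0.
  have := mulr_ge0 h1 u1.
  rewrite /K; nra.
have fdiff (s t : R) : 0 <= s <= 1 -> 0 <= t <= 1 ->
    differentiable f (z + (t * h) *: v + s *: (h *: u)).
  move=> s01 t01; apply: fd; rewrite -ball_normE/= -addrA opprD addNKr normrN.
  by rewrite addrC scalerA (lt_le_trans (small _ _ s01 t01))// ge_min lexx orbT.
(* The increment of [f] along h v, as a function of the position s along h u; [psi 1 - psi 0] is the
   second difference. Writing [1 * h] and [0 * h] makes both terms instances of [fdiff]. *)
pose psi (s : R) : R :=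
  f (z + (1 * h) *: v + s *: (h *: u)) - f (z + (0 * h) *: v + s *: (h *: u)).
pose dpsi (s : R) : R :=
  'D_(h *: u) f (z + (1 * h) *: v + s *: (h *: u)) -
  'D_(h *: u) f (z + (0 * h) *: v + s *: (h *: u)).
have i0 (s : R) : s = 0 -> 0 <= s <= 1 by move=> ->; rewrite lexx ler01.
have i1 (s : R) : s = 1 -> 0 <= s <= 1 by move=> ->; rewrite lexx ler01.
have dpsiE (s : R) : 0 <= s <= 1 -> is_derive s 1 psi (dpsi s).
  by move=> s01; have d1 := is_derive_line (fdiff s 1 s01 (i1 _ erefl));
    have d0 := is_derive_line (fdiff s 0 s01 (i0 _ erefl)); exact: is_deriveB.
have [||s] := @MVT_segment R psi dpsi 0 1 ler01.
- by move=> x; rewrite in_itv/= => /andP[/ltW x0 /ltW x1]; apply: dpsiE; rewrite x0.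
- apply: derivable_within_continuous => x; rewrite in_itv/= => x01.
  by have [] := dpsiE x x01.
rewrite in_itv/= => s01.
rewrite subr0 mulr1 /dpsi !derive_dirZ;
  [|exact: fdiff (i0 _ erefl)|exact: fdiff (i1 _ erefl)].
rewrite -/g => psiE.
have lin' (t : R) : 0 <= t <= 1 ->
   `|g (z + (t * h) *: v + s *: (h *: u)) -
      (g z + 'd g z ((s * h) *: u + (t * h) *: v))| <=
     e / K * `|(s * h) *: u + (t * h) *: v|.
  move=> t01.
  have := lin ((s * h) *: u + (t * h) *: v).
  rewrite -ball_normE/= sub0r normrN (lt_le_trans (small _ _ s01 t01))
    ?ge_min ?lexx// => /(_ isT).
  suff -> : z + (t * h) *: v + s *: (h *: u) = (s * h) *: u + (t * h) *: v + z by [].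
  by rewrite scalerA -addrA addrC [_ *: v + _]addrC.
have := lin' 0 (i0 _ erefl); have := lin' 1 (i1 _ erefl).
have -> : f (z + h *: u + h *: v) - f (z + h *: u) - f (z + h *: v) + f z =
    psi 1 - psi 0.
  by rewrite /psi !scale1r !scale0r !mul0r !mul1r scale0r !addr0
    [z + h *: v + h *: u]addrAC; ring.
rewrite psiE -!/(g _) deriveE//.
have -> : 'd g z ((s * h) *: u + (1 * h) *: v) =
    'd g z ((s * h) *: u + (0 * h) *: v) + h * 'd g z v.
  by rewrite mul0r scale0r addr0 mul1r linearD/= [X in _ + X = _]linearZ.
set A := g (z + (1 * h) *: v + _);
set B := g (z + (0 * h) *: v + _); set d0 := 'd g z _ => lA lB.
have n1 : `|(s * h) *: u + (1 * h) *: v| + `|(s * h) *: u + (0 * h) *: v| <=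
    `|h| * K.
  rewrite mul0r scale0r addr0 mul1r.
  apply: (@le_trans _ _ (`|s * h| * `|u| + `|h| * `|v| + `|s * h| * `|u|)).
    by rewrite -!normrZ lerD2r ler_normD.
  case/andP: s01 => s0 s1; rewrite normrM (ger0_norm s0) /K.
  have := normr_ge0 u; have := normr_ge0 v; have := normr_ge0 h => h1 v1 u1.
  have : s * (`|h| * `|u|) <= 1 * (`|h| * `|u|)
    by apply: ler_wpM2r => //; exact: mulr_ge0.
  nra.
exact: (second_difference_estimate K0 h0 lA lB n1 e0).
Unshelve. all: by end_near. Qed.

(** The second difference is symmetric in [u] and [v], so both mixed derivatives are the limit of
    the same quotient. *)
Lemma derive_comm (R : realType) (V : normedModType R) (f : V -> R)
    (z u v : V) : (\forall x \near z, differentiable f x) ->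
  differentiable ('D_u f) z -> differentiable ('D_v f) z ->
  'D_v ('D_u f) z = 'D_u ('D_v f) z.
Proof.
move=> fd du dv.
have cu := @second_difference_cvg R V f z u v fd du.
have cv := @second_difference_cvg R V f z v u fd dv.
have E (h : R) : f (z + h *: u + h *: v) - f (z + h *: u) - f (z + h *: v) + f z =
    f (z + h *: v + h *: u) - f (z + h *: v) - f (z + h *: u) + f z.
  by rewrite (addrAC z); ring.
move: cu; under eq_fun do rewrite E; move=> cu.
by apply: cvg_unique cu cv.
Qed.

(** * Smooth functions *)

Lemma differentiable_near (R : numFieldType) (V W : normedModType R)
    (f g : V -> W) z : (\forall x \near z, f x = g x) ->
  differentiable f z -> differentiable g z.
Proof.
move=> fg df; have [fc fE] := (diff_locallyP _ _).1 df.
have gE : g \o shift z = cst (g z) + 'd f z +o_ 0 id.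
  apply/eqaddoP => e e0; have /eqaddoP/(_ e e0) := fE.
  have := fg; rewrite (near_shift 0) subr0 => fg0.
  rewrite -(nbhs_singleton fg); apply: filter_app; apply: filterS fg0 => h.
  by rewrite /= !fctE /= => ->.
have dg := diff_unique fc gE.
by apply/diff_locallyP; rewrite dg.
Qed.

Lemma differentiable_mulmx (R : realType) (m k : nat) (B : 'M[R]_(m, k))
    (z : 'rV[R]_m) : differentiable (mulmxr B : 'rV[R]_m -> 'rV[R]_k) z.
Proof.
have -> : (mulmxr B : 'rV[R]_m -> 'rV[R]_k) =
    \sum_(i < m) (fun x : 'rV[R]_m => x 0 i *: row i B).
  by apply/funext => x; rewrite fct_sumE/= mulmx_sum_row.
by apply: differentiable_sum => i; apply: differentiableZl; exact: differentiable_coord.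
Qed.

Lemma mulmxr_continuous (R : realType) (m k : nat) (B : 'M[R]_(m, k)) :
  continuous (mulmxr B : 'rV[R]_m -> 'rV[R]_k).
Proof. by move=> z; apply/differentiable_continuous/differentiable_mulmx. Qed.

Lemma derive_linear (R : realType) (V W W' : normedModType R) (f : V -> W)
    (L : {linear W -> W'}) z v : continuous L -> differentiable f z ->
  'D_v (L \o f) z = L ('D_v f z).
Proof.
move=> Lc df; have dL := linear_differentiable (f z) Lc.
have dLf : differentiable (L \o f) z by exact: differentiable_comp.
by rewrite !deriveE// diff_comp//= diff_lin.
Qed.

Lemma differentiable_linear (R : realType) (V W W' : normedModType R) (f : V -> W)
    (L : {linear W -> W'}) z : continuous L -> differentiable f z ->
  differentiable (L \o f) z.
Proof.
by move=> Lc df; apply: differentiable_comp => //; exact: linear_differentiable.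
Qed.

Lemma derive_linear_id (R : realType) (V W : normedModType R)
    (L : {linear V -> W}) z v : continuous L -> 'D_v L z = L v.
Proof.
by move=> Lc; rewrite deriveE ?diff_lin//; exact: linear_differentiable.
Qed.

Section Open.
Variables (R : realType) (m : nat) (O : set 'rV[R]_m).
Hypothesis Oo : open O.

Lemma open_near (P : 'rV[R]_m -> Prop) z :
  O z -> (forall x, O x -> P x) -> \forall x \near z, P x.
Proof. by move=> Oz PO; apply: filterS PO _; exact: open_nbhs_nbhs. Qed.

Lemma derive_on (V : normedModType R) (f g : 'rV[R]_m -> V) z v :
  (forall x, O x -> f x = g x) -> O z -> 'D_v f z = 'D_v g z.
Proof. by move=> fg Oz; apply: near_eq_derive; exact: open_near. Qed.

(** Derivatives at points of an open set are local, so induction on [k] applies. The closure lemmas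
    below use this to replace a derivative by the formula that a differentiation rule gives on
    [O]. *)
Lemma times_differentiable_on (V : normedModType R) k (f g : 'rV[R]_m -> V) :
  (forall x, O x -> f x = g x) ->
  times_differentiable k O f -> times_differentiable k O g.
Proof.
elim: k f g => [//|k IH] f g fg /= [df Df]; split => [x Ox|v].
  by apply: differentiable_near (df x Ox); exact: open_near.
by apply: IH (Df v) => x Ox; exact: derive_on.
Qed.

Lemma times_differentiable_linear (V W : normedModType R) k
    (f : 'rV[R]_m -> V) (L : {linear V -> W}) : continuous L ->
  times_differentiable k O f -> times_differentiable k O (L \o f).
Proof.
move=> Lc; elim: k f => [//|k IH] f /= [df Df]; split => [x Ox|v].
  by apply: differentiable_linear => //; exact: df.
apply: times_differentiable_on (IH _ (Df v)) => x Ox /=.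
by rewrite derive_linear//; exact: df.
Qed.

Lemma times_differentiableD (V : normedModType R) k (f g : 'rV[R]_m -> V) :
  times_differentiable k O f -> times_differentiable k O g ->
  times_differentiable k O (f + g).
Proof.
elim: k f g => [//|k IH] f g /= [df Df] [dg Dg]; split => [x Ox|v].
  by apply: differentiableD; [exact: df | exact: dg].
apply: times_differentiable_on (IH _ _ (Df v) (Dg v)) => x Ox.
by rewrite deriveD//; apply: diff_derivable; [exact: df | exact: dg].
Qed.

Lemma times_differentiable_cst (V : normedModType R) k (c : V) :
  times_differentiable k O (cst c : 'rV[R]_m -> V).
Proof.
elim: k c => [//|k IH] c /=; split => [x Ox|v]; first exact: differentiable_cst.
by apply: times_differentiable_on (IH 0) => x Ox; rewrite derive_cst.
Qed.

Lemma times_differentiable_sum (V : normedModType R) k p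
    (f : 'I_p -> 'rV[R]_m -> V) : (forall i, times_differentiable k O (f i)) ->
  times_differentiable k O (\sum_(i < p) f i).
Proof.
move=> sf; elim/big_ind: _ => //; first exact: times_differentiable_cst.
exact: times_differentiableD.
Qed.

(** The Leibniz rule leaves one factor undifferentiated, and the induction for products then needs
    that factor at the lower order. *)
Lemma times_differentiable_pred (V : normedModType R) k (f : 'rV[R]_m -> V) :
  times_differentiable k.+1 O f -> times_differentiable k O f.
Proof.
elim: k f => [//|k IH] f [df Df]; split => // v; exact: IH (Df v).
Qed.

Lemma times_differentiableM k (f g : 'rV[R]_m -> R) :
  times_differentiable k O f -> times_differentiable k O g ->
  times_differentiable k O (f * g).
Proof.
elim: k f g => [//|k IH] f g df dg; split => [x Ox|v].
  by apply: differentiableM; [apply: df.1 | apply: dg.1].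
have := times_differentiableD (IH _ _ (times_differentiable_pred df) (dg.2 v))
  (IH _ _ (times_differentiable_pred dg) (df.2 v)).
apply: times_differentiable_on => x Ox.
by rewrite deriveM//; apply: diff_derivable; [apply: df.1 | apply: dg.1].
Qed.

Lemma times_differentiableZl (V : normedModType R) k (f : 'rV[R]_m -> R) (c : V) :
  times_differentiable k O f -> times_differentiable k O (fun x => f x *: c).
Proof.
elim: k f => [//|k IH] f df; split => [x Ox|v].
  by apply: differentiableZl; apply: df.1.
have := IH _ (df.2 v); apply: times_differentiable_on => x Ox.
have dx := df.1 x Ox.
by rewrite !deriveE ?diffZl//; exact: differentiableZl.
Qed.

Lemma times_differentiable_rV p k (f : 'rV[R]_m -> 'rV[R]_p) :
  (forall i, times_differentiable k O (fun x => f x 0 i)) ->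
  times_differentiable k O f.
Proof.
move=> fi.
have := times_differentiable_sum
  (fun i => times_differentiableZl (delta_mx 0 i : 'rV[R]_p) (fi i)).
apply: times_differentiable_on => x Ox.
by rewrite fct_sumE -row_sum_delta.
Qed.

End Open.

(** * Lie derivatives *)

(** The direction varies with the point, so vector fields act as derivations that can be iterated.
    On a vector-valued [f] this differentiates components; the Lie bracket of two fields is
    [bracket]. *)
Definition lie (R : realType) (m : nat) (V : normedModType R)
    (X : 'rV[R]_m -> 'rV[R]_m) (f : 'rV[R]_m -> V) (z : 'rV[R]_m) : V :=
  'D_(X z) f z.

Lemma derive_coord (R : realType) (m p : nat) (f : 'rV[R]_m -> 'rV[R]_p) z v i :
  differentiable f z -> 'D_v (fun x => f x 0 i) z = 'D_v f z 0 i.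
Proof. by move=> df; rewrite derive_mx ?mxE//; exact: diff_derivable. Qed.

Lemma smooth_subset (R : realType) (m : nat) (V : normedModType R)
    (O O' : set 'rV[R]_m) (f : 'rV[R]_m -> V) :
  O' `<=` O -> smooth O f -> smooth O' f.
Proof.
move=> sub sf k; elim: k f sf => [//|k IH] f sf; split => [x /sub Ox|v].
  by apply: (sf 1%N).1.
by apply: IH => j; exact: (sf j.+1).2.
Qed.

Section Smooth.
Variables (R : realType) (m : nat) (O : set 'rV[R]_m).
Hypothesis Oo : open O.
Implicit Types (f g : 'rV[R]_m -> R) (X Y : 'rV[R]_m -> 'rV[R]_m).

Lemma smooth_differentiable (V : normedModType R) (f : 'rV[R]_m -> V) z :
  smooth O f -> O z -> differentiable f z.
Proof. by move=> /(_ 1%N) [df _]; exact: df. Qed.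

Lemma smooth_derive (V : normedModType R) (f : 'rV[R]_m -> V) v :
  smooth O f -> smooth O ('D_v f).
Proof. by move=> sf k; exact: (sf k.+1).2. Qed.

Lemma smooth_on (V : normedModType R) (f g : 'rV[R]_m -> V) :
  (forall x, O x -> f x = g x) -> smooth O f -> smooth O g.
Proof. by move=> fg sf k; exact: times_differentiable_on (sf k). Qed.

Lemma smooth_linear (V W : normedModType R) (f : 'rV[R]_m -> V)
    (L : {linear V -> W}) : continuous L -> smooth O f -> smooth O (L \o f).
Proof. by move=> Lc sf k; exact: times_differentiable_linear. Qed.

Lemma smooth_id : smooth O (id : 'rV[R]_m -> 'rV[R]_m).
Proof.
case=> [//|k]; split => [x _|v].
  by have [] := is_diff_id x.
apply: (@times_differentiable_on _ _ _ Oo _ _ (cst v)) => [x Ox|].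
  by rewrite derive_id.
exact: times_differentiable_cst.
Qed.

Lemma smoothD (V : normedModType R) (f g : 'rV[R]_m -> V) :
  smooth O f -> smooth O g -> smooth O (f + g).
Proof. by move=> sf sg k; exact: times_differentiableD. Qed.

Lemma smooth_cst (V : normedModType R) (c : V) : smooth O (cst c : 'rV[R]_m -> V).
Proof. by move=> k; exact: times_differentiable_cst. Qed.

Lemma smoothZ (V : normedModType R) (f : 'rV[R]_m -> V) (c : R) :
  smooth O f -> smooth O (c \*: f).
Proof.
move=> sf.
have := @smooth_linear _ _ f (GRing.scale c) (@scaler_continuous _ _ c) sf.
by [].
Qed.

Lemma smoothM f g : smooth O f -> smooth O g -> smooth O (f * g).
Proof. by move=> sf sg k; exact: times_differentiableM. Qed.

Lemma smooth_sum (V : normedModType R) p (f : 'I_p -> 'rV[R]_m -> V) :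
  (forall i, smooth O (f i)) -> smooth O (\sum_(i < p) f i).
Proof. by move=> sf k; apply: times_differentiable_sum => // i; exact: sf. Qed.

Lemma smooth_rV p (f : 'rV[R]_m -> 'rV[R]_p) :
  (forall i, smooth O (fun x => f x 0 i)) -> smooth O f.
Proof. by move=> sf k; apply: times_differentiable_rV => // i; exact: sf. Qed.

Lemma smooth_coord p (f : 'rV[R]_m -> 'rV[R]_p) i :
  smooth O f -> smooth O (fun x => f x 0 i).
Proof.
move=> sf k; elim: k f sf => [//|k IH] f sf; split => [x Ox|v].
  apply: (@differentiable_comp _ _ _ _ f (fun N : 'rV[R]_p => N 0 i)).
    exact: smooth_differentiable.
  exact: differentiable_coord.
have := IH _ (smooth_derive v sf); apply: times_differentiable_on => // x Ox.
by rewrite derive_coord//; exact: smooth_differentiable.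
Qed.

Lemma lie_sum f X z : differentiable f z ->
  lie X f z = (\sum_(i < m) (fun x => X x 0 i) * 'D_(delta_mx 0 i) f) z.
Proof. by move=> df; rewrite /lie derive_dir_sum// fct_sumE. Qed.

Lemma smooth_lie f X : smooth O X -> smooth O f -> smooth O (lie X f).
Proof.
move=> sX sf.
have : smooth O (\sum_(i < m) (fun x => X x 0 i) * 'D_(delta_mx 0 i) f).
  apply: smooth_sum => i; apply: smoothM; first exact: smooth_coord.
  exact: smooth_derive.
apply: smooth_on => x Ox; rewrite lie_sum//; exact: smooth_differentiable.
Qed.

Lemma smooth_lie_rV p (Y : 'rV[R]_m -> 'rV[R]_p) X :
  smooth O X -> smooth O Y -> smooth O (lie X Y).
Proof.
move=> sX sY; apply: smooth_rV => i.
apply: (smooth_on (f := lie X (fun x => Y x 0 i))).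
  by move=> x Ox; rewrite /lie derive_coord//; exact: smooth_differentiable.
by apply: smooth_lie => //; exact: smooth_coord.
Qed.

(** Product rule for df(X): one term differentiates the direction [X], the other freezes it at
    [X z]. Since [dd_J] and [metric] are built from frozen directions, this is the bridge between
    them and iterated [lie] derivatives. *)
Lemma derive_lie f X z v : smooth O X -> smooth O f -> O z ->
  'D_v (lie X f) z = 'D_('D_v X z) f z + 'D_v ('D_(X z) f) z.
Proof.
move=> sX sf Oz.
have df i x : O x -> differentiable ('D_(delta_mx 0 i) f) x.
  by move=> Ox; apply: smooth_differentiable Ox; exact: smooth_derive.
have dX i x : O x -> differentiable (fun x => X x 0 i) x.
  by move=> Ox; apply: smooth_differentiable Ox; exact: smooth_coord.
have dfx x : O x -> differentiable f x by exact: smooth_differentiable.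
rewrite (derive_on Oo (f := lie X f)
  (g := \sum_(i < m) (fun x => X x 0 i) * 'D_(delta_mx 0 i) f))//; last first.
  by move=> x Ox; rewrite lie_sum//; exact: dfx.
rewrite (derive_on Oo (f := 'D_(X z) f)
  (g := \sum_(i < m) X z 0 i \*: 'D_(delta_mx 0 i) f))//; last first.
  by move=> x Ox; rewrite derive_dir_sum ?fct_sumE//; exact: dfx.
rewrite [X in _ = X + _]derive_dir_sum; last exact: dfx.
rewrite !derive_sum; first last.
- by move=> i; apply: derivableM; apply: diff_derivable; [exact: dX | exact: df].
- by move=> i; apply: derivableZ; apply: diff_derivable; exact: df.
rewrite -big_split; apply: eq_bigr => i _ /=.
have d1 : derivable ('D_(delta_mx 0 i) f) z v by apply: diff_derivable; exact: df.
have d2 : derivable (fun x => X x 0 i) z v by apply: diff_derivable; exact: dX.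
have E1 : 'D_v (X z 0 i \*: 'D_(delta_mx 0 i) f) z =
    X z 0 i * 'D_v ('D_(delta_mx 0 i) f) z :=
  deriveZ _ d1.
have E2 := deriveM d2 d1.
have E3 := @derive_coord _ _ _ _ _ v i (smooth_differentiable sX Oz).
by rewrite E1 E2 E3 /GRing.scale/= addrC [_ * ('D_v X z 0 i)]mulrC.
Qed.

(** By [derive_lie] both iterated derivatives split; the second-order terms with frozen directions
    agree by symmetry, and the first-order terms form the bracket. *)
Lemma lie_bracket f X Y z : smooth O X -> smooth O Y -> smooth O f -> O z ->
  lie X (lie Y f) z - lie Y (lie X f) z = 'D_(bracket X Y z) f z.
Proof.
move=> sX sY sf Oz; rewrite {1}/lie {2}/lie.
rewrite (derive_lie (X z) sY sf Oz) (derive_lie (Y z) sX sf Oz).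
have := @derive_comm R _ f z (X z) (Y z).
move=> -> //; last 3 first.
- by apply: (open_near Oo Oz) => x Ox; exact: smooth_differentiable.
- by apply: smooth_differentiable Oz; exact: smooth_derive.
- by apply: smooth_differentiable Oz; exact: smooth_derive.
have gen (a b c : R) : (a + c) - (b + c) = a - b by ring.
have df : differentiable f z by exact: smooth_differentiable Oz.
by rewrite gen /bracket derive_dirB.
Qed.

Lemma lieD f g X z : smooth O f -> smooth O g -> O z ->
  lie X (f + g) z = lie X f z + lie X g z.
Proof.
by move=> sf sg Oz; apply: deriveD;
  apply: diff_derivable; exact: smooth_differentiable Oz.
Qed.

Lemma lieZ f c X z : smooth O f -> O z -> lie X (c \*: f) z = c * lie X f z.
Proof.
by move=> sf Oz; apply: deriveZ;
  apply: diff_derivable; exact: smooth_differentiable Oz.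
Qed.

Lemma lieM f g X z : smooth O f -> smooth O g -> O z ->
  lie X (f * g) z = f z * lie X g z + g z * lie X f z.
Proof.
by move=> sf sg Oz; apply: deriveM;
  apply: diff_derivable; exact: smooth_differentiable Oz.
Qed.

Lemma lie_on f g X z : (forall x, O x -> f x = g x) -> O z -> lie X f z = lie X g z.
Proof. by move=> fg Oz; exact: (derive_on Oo). Qed.

Lemma lie_on0 f X z : (forall x, O x -> f x = 0) -> O z -> lie X f z = 0.
Proof.
move=> f0 Oz; rewrite (lie_on (g := cst 0) X f0 Oz); exact: derive_cst.
Qed.

Lemma lie_onZ f g c X z : smooth O g -> (forall x, O x -> f x = c * g x) ->
  O z -> lie X f z = c * lie X g z.
Proof. by move=> sg fg Oz; rewrite (lie_on (g := c \*: g) X fg Oz) lieZ. Qed.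

End Smooth.

(** * Derivations attached to a concurrent field *)

Section ConcurrentBrackets.
Variables (R : realType) (m : nat) (O : set 'rV[R]_m).
Hypothesis Oo : open O.
Variables (G V C H : 'rV[R]_m -> 'rV[R]_m) (E : 'rV[R]_m -> R).
Hypotheses (sG : smooth O G) (sV : smooth O V) (sC : smooth O C)
  (sH : smooth O H) (sE : smooth O E).
Hypothesis brVG : forall z, O z -> bracket V G z = H z + C z.
Hypothesis brHV : forall z, O z -> bracket H V z = - V z.
Hypothesis brCV : forall z, O z -> bracket C V z = - V z.
Hypothesis GE : forall z, O z -> lie G E z = 0.
Hypothesis HE : forall z, O z -> lie H E z = 0.
Hypothesis CE : forall z, O z -> lie C E z = 2 * E z.

Let Phi := lie V E.
Let p := lie V Phi.

Let sPhi : smooth O Phi. Proof. exact: smooth_lie. Qed.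

Let dirD f x y z : smooth O f -> O z -> 'D_(x + y) f z = 'D_x f z + 'D_y f z :> R.
Proof. by move=> sf Oz; rewrite derive_dirD//; exact: smooth_differentiable Oz. Qed.

Let dirN f x z : smooth O f -> O z -> 'D_(- x) f z = - 'D_x f z :> R.
Proof. by move=> sf Oz; rewrite derive_dirN//; exact: smooth_differentiable Oz. Qed.

(** Apply [V,G] = H + C to E: the term V(GE) vanishes, leaving -G Phi = HE + CE. *)
Lemma lie_spray_pairing z : O z -> lie G Phi z = - (2 * E z).
Proof.
move=> Oz; have := lie_bracket Oo sV sG sE Oz.
rewrite brVG// dirD// (lie_on0 Oo V GE Oz).
rewrite -[X in _ = X + _]/(lie H E z) -[X in _ = _ + X]/(lie C E z) HE// CE//; lra.
Qed.

Lemma lie_horizontal_pairing z : O z -> lie H Phi z = - Phi z.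
Proof.
move=> Oz; have := lie_bracket Oo sH sV sE Oz.
by rewrite brHV// dirN// (lie_on0 Oo V HE Oz) subr0.
Qed.

(** The relation [C,V] = -V lowers the degree of homogeneity from 2 to 1. A general [f] is allowed
    because the energies of both F and L are substituted later. *)
Lemma lie_liouville_lift (f : 'rV[R]_m -> R) z : smooth O f ->
  (forall x, O x -> lie C f x = 2 * f x) -> O z -> lie C (lie V f) z = lie V f z.
Proof.
move=> sf Cf Oz; have := lie_bracket Oo sC sV sf Oz.
rewrite brCV// dirN// (lie_onZ Oo V sf Cf Oz).
by rewrite -[X in _ = - X]/(lie V f z); lra.
Qed.

(** Apply [V,G] = H + C to Phi: the right side H Phi + C Phi cancels, so G p = V(G Phi) = -2 VE. *)
Lemma lie_spray_norm z : O z -> lie G p z = - (2 * Phi z).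
Proof.
move=> Oz; have := lie_bracket Oo sV sG sPhi Oz.
have E2 x : O x -> lie G Phi x = -2 * E x.
  by move=> Ox; rewrite lie_spray_pairing// mulNr.
rewrite brVG// (dirD _ _ sPhi Oz) (lie_onZ Oo V sE E2 Oz).
rewrite -[X in _ = X + _]/(lie H Phi z) -[X in _ = _ + X]/(lie C Phi z).
rewrite lie_horizontal_pairing// (lie_liouville_lift sE CE Oz).
rewrite -/Phi -/p; lra.
Qed.

End ConcurrentBrackets.

(* [GVL] stands for the value at a point of G(V(L)), and so on; [u] is F - Phi,
   [P] is the projective factor. *)
Lemma matsumoto_identity (R : realFieldType)
    (F u L VF p GL VL GVL HL GVF Gu Vu Hu GVu GPhi Phi P : R) : F != 0 ->
  u = F - Phi -> L * u = F ^+ 2 -> F * VF = Phi -> Vu = VF - p ->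
  Gu = F ^+ 2 -> Hu = Phi -> GPhi = - F ^+ 2 -> F * GVF = GPhi ->
  GVu = GVF + 2 * Phi ->
  GL * u + L * Gu = 0 -> HL * u + L * Hu = 0 -> VL * u + L * Vu = 2 * Phi ->
  GVL * u + VL * Gu + (GL * Vu + L * GVu) = 2 * GPhi ->
  L * GL = 2 * P * L ^+ 2 ->
  GL * VL + L * GVL - 2 * P * (L * VL) = L * HL - L ^+ 2 ->
  Phi ^+ 2 = F ^+ 2 * p.
Proof.
move=> F0 uE Lu VFE VuE -> -> GPhiE GVFE GVuE GLE HLE VLE GVLE A1 A2.
have F20 : F ^+ 2 != 0 by rewrite expf_neq0.
have u0 : u != 0 by apply: contraNneq F20 => u0; rewrite -Lu u0 mulr0.
have L0 : L != 0 by apply: contraNneq F20 => L0; rewrite -Lu L0 mul0r.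
(* The first spray equation, conservation of the energy of L, determines the projective factor;
   substituting it in the second one eliminates [P]. *)
have GLP : GL = 2 * P * L.
  by apply: (mulfI L0); rewrite A1; ring.
have key : GVL = HL - L.
  by apply: (mulfI L0); move: A2; rewrite GLP => A2; lra.
have VF' : VF = Phi / F by rewrite -VFE; field.
have GVF' : GVF = - F by apply: (mulfI F0); rewrite GVFE GPhiE; ring.
have L' : L = F ^+ 2 / u by rewrite -Lu; field.
have GL' : GL = - (L * F ^+ 2) / u.
  by apply: (mulIf u0); rewrite mulfVK//; lra.
have HL' : HL = - (L * Phi) / u.
  by apply: (mulIf u0); rewrite mulfVK//; lra.
have VL' : VL = (2 * Phi - L * Vu) / u.
  by apply: (mulIf u0); rewrite mulfVK//; lra.
have GVL' : GVL = (2 * GPhi - VL * F ^+ 2 - (GL * Vu + L * GVu)) / u.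
  by apply: (mulIf u0); rewrite mulfVK//; lra.
apply/eqP; rewrite -subr_eq0.
(* Once every derivative is expressed through [F], [Phi] and [p], the defect in [key] is 2 F^2 / u^3
   times the defect in the Cauchy-Schwarz equality. *)
have -> : Phi ^+ 2 - F ^+ 2 * p = u ^+ 3 / (2 * F ^+ 2) * (GVL - (HL - L)).
  rewrite GVL' HL' VL' GL' L' GPhiE GVuE GVF' VuE VF' uE; field.
  by rewrite -uE u0 F0.
by rewrite key subrr mulr0.
Qed.

(** * Lifts to the tangent bundle *)

Section Lifts.
Variables (R : realType) (n : nat).

Lemma gammaE : @gamma R n = mulmxr (row_mx 0 1%:M).
Proof. by apply/funext => w; rewrite /gamma /= mul_mx_row mulmx0 mulmx1. Qed.

Lemma row_mx0E (w : 'rV[R]_n) : row_mx w (0 : 'rV[R]_n) = mulmxr (row_mx 1%:M 0) w.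
Proof. by rewrite /= mul_mx_row mulmx0 mulmx1. Qed.

Lemma gamma_inj : injective (@gamma R n).
Proof. by move=> u v /(congr1 rsubmx); rewrite !row_mxKr. Qed.

Lemma gamma0 : gamma 0 = 0 :> 'rV[R]_(n + n).
Proof. by rewrite /gamma row_mx0. Qed.

Lemma JendE (X : 'rV[R]_(n + n)) : Jend X = gamma (lsubmx X).
Proof. by []. Qed.

Lemma derive_gamma m (f : 'rV[R]_m -> 'rV[R]_n) z v : differentiable f z ->
  'D_v (fun x => gamma (f x)) z = gamma ('D_v f z).
Proof.
move=> df; rewrite gammaE.
exact: (derive_linear v (@mulmxr_continuous R n (n + n) (row_mx 0 1%:M)) df).
Qed.

Lemma derive_lsubmx m (f : 'rV[R]_m -> 'rV[R]_(n + n)) z v : differentiable f z ->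
  'D_v (fun x => lsubmx (f x)) z = lsubmx ('D_v f z).
Proof.
move=> df.
exact: (derive_linear (L := lsubmx) v (@continuous_lsubmx _ _ _ _) df).
Qed.

Lemma derive_rsubmx_id (z v : 'rV[R]_(n + n)) : 'D_v (@rsubmx R 1 n n) z = rsubmx v.
Proof. exact: (derive_linear_id (L := rsubmx) z v (@continuous_rsubmx _ _ _ _)). Qed.

Lemma differentiable_eta z : differentiable (@eta R n) z.
Proof. exact: differentiable_rsubmx. Qed.

Lemma derive_liouville z v : 'D_v (@liouville R n) z = gamma (rsubmx v).
Proof.
rewrite (derive_gamma (f := @eta R n)); last exact: differentiable_eta.
by rewrite derive_rsubmx_id.
Qed.

Variable O : set 'rV[R]_(n + n).
Hypothesis Oo : open O.

Lemma smooth_gamma (f : 'rV[R]_(n + n) -> 'rV[R]_n) :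
  smooth O f -> smooth O (fun x => gamma (f x)).
Proof.
move=> sf; rewrite gammaE.
exact: (smooth_linear Oo (@mulmxr_continuous R n (n + n) (row_mx 0 1%:M)) sf).
Qed.

Lemma smooth_row_mx0 (f : 'rV[R]_(n + n) -> 'rV[R]_n) :
  smooth O f -> smooth O (fun x => row_mx (f x) (0 : 'rV[R]_n)).
Proof.
move=> sf; under eq_fun do rewrite row_mx0E.
exact: (smooth_linear Oo (@mulmxr_continuous R n (n + n) (row_mx 1%:M 0)) sf).
Qed.

Lemma smooth_eta : smooth O (@eta R n).
Proof.
exact: (smooth_linear (L := rsubmx) Oo (@continuous_rsubmx _ _ _ _) (smooth_id Oo)).
Qed.

Lemma smooth_liouville : smooth O (@liouville R n).
Proof. exact: smooth_gamma smooth_eta. Qed.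

(** The metric is the vertical Hessian of the energy: the other term of [dd_J] disappears because J
    kills vertical vectors. *)
Lemma metricE (F : 'rV[R]_(n + n) -> R) z u v :
  metric F z u v = 'D_(gamma u) ('D_(gamma v) (energy F)) z.
Proof.
rewrite /metric /dd_J /ext_d /d_J.
have -> : Jend (row_mx v 0) = gamma v by rewrite JendE row_mxKl.
have -> : Jend (gamma u) = 0 by rewrite JendE row_mxKl gamma0.
have -> : (fun z' => 'D_(0 : 'rV[R]_(n + n)) (energy F) z') = cst 0.
  by apply/funext => x; rewrite derive0.
by rewrite derive_cst subr0.
Qed.

(** Euler's relation: moving from [z] by h C(z) is the fibre scaling by 1 + h, positive for |h| < 1,
    so the difference quotient is constant. *)
Lemma derive_homogeneous (f : 'rV[R]_(n + n) -> R) z :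
  (forall t, 0 < t -> f (fib_scale t z) = t * f z) -> lie (@liouville R n) f z = f z.
Proof.
move=> fh; rewrite /lie /derive; apply: cvg_lim => //.
apply: cvg_near_cst; near=> h.
have h0 : h != 0 by near: h; exact: nbhs_dnbhs_neq.
have h1 : 0 < 1 + h.
  have : `|h| < 1 by near: h; exact: dnbhs0_lt.
  by rewrite ltr_norml => /andP[]; lra.
have -> : (f \o shift z) (h *: liouville z) = (1 + h) * f z.
  rewrite -fh//= /liouville /gamma /eta /fib_scale; congr f.
  rewrite scale_row_mx scaler0 -{2}(hsubmxK z) add_row_mx add0r.
  by rewrite scalerDl scale1r addrC.
by rewrite mulrDl mul1r addrAC subrr add0r /GRing.scale/= mulKf.
Unshelve. all: by end_near. Qed.

(** [X] is the value of a spray at [z]. Testing with Y = X gives conservation of energy by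
    antisymmetry; testing with Y = (w, 0) gives the Euler-Lagrange equation, where the Liouville
    field is constant along (w, 0) and Euler's relation evaluates the second term. *)
Lemma spray_equations (E : 'rV[R]_(n + n) -> R) z X : smooth O E ->
  (forall x, O x -> lie (@liouville R n) E x = 2 * E x) -> O z ->
  Jend X = liouville z -> (forall Y, dd_J E z X Y = - 'D_Y E z) ->
  'D_X E z = 0 /\ forall w, 'D_X ('D_(gamma w) E) z = 'D_(row_mx w 0) E z.
Proof.
have gen (a b : R) : a - 2 * b = - b -> a = b by lra.
move=> sE CE Oz JX hX; split.
  by apply/eqP; rewrite -oppr_eq0 -hX /dd_J /ext_d subrr.
move=> w; have := hX (row_mx w 0).
rewrite /dd_J /ext_d /d_J JX.
have -> : Jend (row_mx w 0) = gamma w by rewrite JendE row_mxKl.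
have sC := smooth_liouville.
have := derive_lie Oo (row_mx w 0) sC sE Oz.
rewrite derive_liouville row_mxKr gamma0 derive0 add0r => CE'.
have CE2 : 'D_(row_mx w 0) (lie (@liouville R n) E) z = 2 * 'D_(row_mx w 0) E z.
  exact: (lie_onZ Oo (cst (row_mx w 0)) sE CE Oz).
rewrite CE' in CE2; rewrite CE2.
exact: gen.
Qed.

End Lifts.

(** * Sprays and the Berwald connection *)

Section Spray.
Variables (R : realType) (n : nat) (O : set 'rV[R]_(n + n)).
Hypothesis Oo : open O.
Variable G : 'rV[R]_(n + n) -> 'rV[R]_(n + n).
Hypothesis sG : smooth O G.
Hypothesis JG : forall z, O z -> Jend (G z) = liouville z.

Lemma lsubmx_spray z : O z -> lsubmx (G z) = rsubmx z.
Proof. by move=> Oz; apply: gamma_inj; exact: JG. Qed.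

Lemma lsubmx_derive_spray z v : O z -> lsubmx ('D_v G z) = rsubmx v.
Proof.
move=> Oz; rewrite -derive_lsubmx; last exact: smooth_differentiable Oz.
rewrite -(derive_rsubmx_id z v); apply: (derive_on Oo) => // x Ox.
exact: lsubmx_spray.
Qed.

(** Since the first half of G is [y], the vertical part of [X] cancels; hence the horizontal
    projection depends on [lsubmx X] alone. *)
Lemma hprojE z X : O z ->
  hproj G z X = 2^-1 *: (row_mx (lsubmx X) 0 + 'D_(gamma (lsubmx X)) G z).
Proof.
move=> Oz; rewrite /hproj /barthel /bracket !derive_cst !subr0; congr (_ *: _).
have -> : Jend ('D_X G z) = gamma (rsubmx X) by rewrite JendE lsubmx_derive_spray.
rewrite JendE addrCA addrC; congr (_ + _).
by rewrite -{1}(hsubmxK X) /gamma opp_row_mx add_row_mx oppr0 addr0 subrr.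
Qed.

Lemma vprojE z X : vproj G z X = X - hproj G z X.
Proof.
rewrite /vproj /hproj; set B := barthel G z X.
by apply/rowP => i; rewrite !mxE; field.
Qed.

Lemma hproj_lsubmx z X Y : O z -> lsubmx X = lsubmx Y -> hproj G z X = hproj G z Y.
Proof. by move=> Oz XY; rewrite (hprojE X Oz) (hprojE Y Oz) XY. Qed.

Lemma lsubmx_hproj z X : O z -> lsubmx (hproj G z X) = lsubmx X.
Proof.
move=> Oz; rewrite (hprojE X Oz) linearZ/= linearD/= row_mxKl lsubmx_derive_spray//.
by rewrite row_mxKr; apply/rowP => i; rewrite !mxE; field.
Qed.

(** The choice made by [xget] is forced: a vector in the image of the projector is determined by its
    first half, and (w, 0) supplies a preimage. *)
Lemma betaE z w : O z -> beta G z w = hproj G z (row_mx w 0).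
Proof.
move=> Oz; rewrite /beta; case: xgetP => [X ->|noX].
  by move=> [[Y _ <-]]; rewrite /rho (lsubmx_hproj Y Oz) => YE;
    apply: (hproj_lsubmx Oz); rewrite row_mxKl.
case: (noX (hproj G z (row_mx w 0))); split; first by exists (row_mx w 0).
by rewrite /rho (lsubmx_hproj _ Oz) row_mxKl.
Qed.

Hypothesis CG : forall z, O z -> bracket (@liouville R n) G z = G z.

(** A spray is horizontal: [C,G] = G computes the derivative of G along C and doubles the second
    half of G, which the factor 1/2 undoes. *)
Lemma hproj_eta z : O z -> hproj G z (row_mx (rsubmx z) 0) = G z.
Proof.
move=> Oz; rewrite hprojE// row_mxKl.
have := CG Oz; rewrite /bracket derive_liouville => /eqP; rewrite subr_eq => /eqP.
rewrite /liouville /eta => ->.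
have -> : G z = row_mx (rsubmx z) (rsubmx (G z)) by rewrite -(lsubmx_spray Oz) hsubmxK.
rewrite /gamma row_mxKr !add_row_mx scale_row_mx.
by congr row_mx; apply/rowP => i; rewrite !mxE; field.
Qed.

Variables (Dc : connection R n) (phi : 'rV[R]_(n + n) -> 'rV[R]_n).
Hypothesis Dc_berwald : berwald O G Dc.
Hypothesis sphi : smooth O phi.
Hypothesis Dc_hor : forall z w, O z -> Dc z (beta G z w) phi = - w.
Hypothesis Dc_ver : forall z w, O z -> Dc z (gamma w) phi = 0.

Let V z := gamma (phi z).
Let H z := hproj G z (row_mx (phi z) 0).
Let dphi z : O z -> differentiable phi z. Proof. exact: smooth_differentiable. Qed.

Lemma smooth_hproj_lift : smooth O H.
Proof.
have sV := smooth_gamma Oo sphi.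
have := smoothZ Oo (2^-1) (smoothD Oo (smooth_row_mx0 Oo sphi) (smooth_lie_rV Oo sV sG)).
apply: (smooth_on Oo) => z Oz.
by rewrite /H (hprojE _ Oz) row_mxKl.
Qed.

(** The components of [phi] depend on x only. For a constant [w], the vertical Berwald formula
    reduces to the derivative of rho(beta phi) = phi along gamma w. *)
Lemma concurrent_vertical z w : O z -> 'D_(gamma w) phi z = 0.
Proof.
move=> Oz; rewrite -(Dc_ver w Oz).
have [_ Dv] := Dc_berwald Oo (@subset_refl _ O).
rewrite (Dv (fun=> w) phi (smooth_cst Oo w) sphi z Oz).
rewrite /bracket /rho.
have sH := smooth_hproj_lift.
cbv beta; rewrite derive_cst subr0 (derive_on Oo (g := H))//; last first.
  by move=> x Ox; rewrite betaE.
rewrite -derive_lsubmx; last exact: smooth_differentiable Oz.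
apply: (derive_on Oo) => // x Ox.
by rewrite /H (lsubmx_hproj _ Ox) row_mxKl.
Qed.

Lemma derive_lift z v : O z -> 'D_v V z = gamma ('D_v phi z).
Proof. by move=> Oz; rewrite derive_gamma//; exact: dphi. Qed.

(** Take Z the lift of eta, whose horizontal projection is G, and W the lift of [phi]: concurrence
    makes the vertical part of [G,V] equal to -C. Its image under rho is -phi, so its horizontal
    part is -H. *)
Lemma bracket_spray_lift z : O z -> bracket V G z = H z + liouville z.
Proof.
move=> Oz; have [Dh _] := Dc_berwald Oo (@subset_refl _ O).
have := Dh (fun z => row_mx (rsubmx z) 0) (fun z => row_mx (phi z) 0)
  (smooth_row_mx0 Oo (smooth_eta Oo)) (smooth_row_mx0 Oo sphi) z Oz.
rewrite /rho; under [X in Dc _ _ X]eq_fun do rewrite row_mxKl.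
rewrite -betaE// Dc_hor//.
rewrite /bracket hproj_eta//.
rewrite (derive_on Oo (f := fun x => Jend (row_mx (phi x) 0)) (g := V)
  _ _ Oz); last by move=> x _; rewrite JendE row_mxKl.
rewrite (derive_on Oo (f := fun x => hproj G x (row_mx (rsubmx x) 0)) (g := G)
  _ _ Oz); last exact: hproj_eta.
rewrite JendE row_mxKl -/(V z) vprojE (hprojE _ Oz).
have -> : lsubmx ('D_(G z) V z - 'D_(V z) G z) = - phi z.
  by rewrite linearB/= derive_lift// row_mxKl lsubmx_derive_spray// row_mxKr sub0r.
rewrite /H (hprojE _ Oz) row_mxKl /liouville /eta /gamma => E.
have -> : row_mx 0 (rsubmx z) = - row_mx 0 (- rsubmx z) :> 'rV[R]_(n + n).
  by rewrite opp_row_mx oppr0 opprK.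
rewrite E.
have -> : row_mx 0 (- phi z) = - row_mx 0 (phi z) :> 'rV[R]_(n + n).
  by rewrite opp_row_mx oppr0.
have -> : row_mx (- phi z) 0 = - row_mx (phi z) 0 :> 'rV[R]_(n + n).
  by rewrite opp_row_mx oppr0.
have dG : differentiable G z by exact: smooth_differentiable Oz.
rewrite derive_dirN//.
rewrite -/(gamma (phi z)) -/(V z).
by apply/rowP => i; rewrite !mxE; field.
Qed.

(** The same formula with both fields the lift of [phi]. Here the bracket is purely vertical,
    because rho(H) = phi is constant along V. *)
Lemma bracket_horizontal_lift z : O z -> bracket H V z = - V z.
Proof.
move=> Oz; have [Dh _] := Dc_berwald Oo (@subset_refl _ O).
have sl := smooth_row_mx0 Oo sphi.
have := Dh (fun z => row_mx (phi z) 0) (fun z => row_mx (phi z) 0) sl sl z Oz.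
rewrite /rho; under [X in Dc _ _ X]eq_fun do rewrite row_mxKl.
rewrite -betaE// Dc_hor//.
rewrite /bracket -/H -/(H z).
rewrite (derive_on Oo (f := fun x => Jend (row_mx (phi x) 0)) (g := V)
  _ _ Oz); last by move=> x _; rewrite JendE row_mxKl.
rewrite JendE row_mxKl -/(V z) vprojE (hprojE _ Oz).
have sH := smooth_hproj_lift.
have -> : lsubmx ('D_(H z) V z - 'D_(V z) H z) = 0.
  rewrite linearB/= derive_lift// row_mxKl sub0r -derive_lsubmx;
    last exact: smooth_differentiable Oz.
  rewrite (derive_on Oo (f := fun x => lsubmx (H x)) (g := phi) _ _ Oz);
    last by move=> x Ox; rewrite /H (lsubmx_hproj _ Ox) row_mxKl.
  by rewrite concurrent_vertical// oppr0.
rewrite gamma0 derive0 row_mx0 addr0 scaler0 subr0 => <-.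
by rewrite /V /gamma opp_row_mx oppr0.
Qed.

Lemma bracket_liouville_lift z : O z -> bracket (@liouville R n) V z = - V z.
Proof.
move=> Oz; rewrite /bracket derive_liouville derive_lift//.
by rewrite concurrent_vertical// gamma0 sub0r row_mxKr.
Qed.

End Spray.

(** * The metric and the projective relation in a chart *)

(** Coordinates l and j of A f = P y and of its derivative in the fibre direction e_j, with f
    constant on fibres; [a], [b] are the derivatives of [A], [P]. Coordinate l gives P a = A b, and
    coordinate j then leaves only A P. *)
Lemma parallel_arith (K : fieldType) (A P yl yj fl fj a b : K) : yl != 0 ->
  A * fl = P * yl -> A * fj = P * yj -> fl * a = yl * b -> fj * a = P + yj * b ->
  A * P = 0.
Proof.
move=> yl0 pl pj kl kj.
have PaAb : P * a = A * b.
  by apply: (mulfI yl0); rewrite mulrCA mulrA -pl -mulrA kl; ring.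
have -> : A * P = A * (fj * a) - A * (yj * b) by rewrite kj; ring.
by rewrite mulrA pj [A * _]mulrCA -PaAb; ring.
Qed.

Section Chart.
Variables (R : realType) (n : nat) (O : set 'rV[R]_(n + n)).
Hypothesis Oo : open O.
Implicit Types (F E L : 'rV[R]_(n + n) -> R).

Lemma smooth_energy F : smooth O F -> smooth O (energy F).
Proof.
move=> sF; have := smoothZ Oo 2^-1 (smoothM Oo sF sF).
by apply: (smooth_on Oo) => x _; rewrite /energy expr2.
Qed.

Lemma lie_energy F X z : smooth O F -> O z -> lie X (energy F) z = F z * lie X F z.
Proof.
move=> sF Oz.
have E x : O x -> energy F x = 2^-1 * (F * F) x by move=> _; rewrite /energy expr2.
rewrite (lie_onZ Oo X (smoothM Oo sF sF) E Oz) (lieM X sF sF Oz).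
by field.
Qed.

Lemma lie_liouville_energy F z : smooth O F -> O z ->
  lie (@liouville R n) F z = F z -> lie (@liouville R n) (energy F) z = 2 * energy F z.
Proof. by move=> sF Oz CF; rewrite lie_energy// CF /energy; field. Qed.

Lemma gamma_subZ (a b : R) (v w : 'rV[R]_n) :
  gamma (a *: v - b *: w) = a *: gamma v - b *: gamma w.
Proof. by rewrite /gamma !scale_row_mx opp_row_mx add_row_mx !scaler0 subr0. Qed.

Lemma metric_subZl F z (a b : R) v w t : smooth O F -> O z ->
  metric F z (a *: v - b *: w) t = a * metric F z v t - b * metric F z w t.
Proof.
move=> sF Oz; rewrite !metricE gamma_subZ.
have dE : differentiable ('D_(gamma t) (energy F)) z.
  by apply: smooth_differentiable Oz; apply: smooth_derive; exact: smooth_energy.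
by rewrite derive_dirB// !derive_dirZ.
Qed.

Lemma metric_subZr F z (a b : R) v w t : smooth O F -> O z ->
  metric F z t (a *: v - b *: w) = a * metric F z t v - b * metric F z t w.
Proof.
move=> sF Oz; have sE := smooth_energy sF; rewrite !metricE.
have dE v' : derivable ('D_(gamma v') (energy F)) z (gamma t).
  by apply: diff_derivable; apply: smooth_differentiable Oz; exact: smooth_derive.
rewrite (derive_on Oo
  (g := a \*: 'D_(gamma v) (energy F) - b \*: 'D_(gamma w) (energy F)) _ _ Oz); last first.
  move=> x Ox; have dx : differentiable (energy F) x by exact: smooth_differentiable Ox.
  by rewrite gamma_subZ derive_dirB// !derive_dirZ.
have d1 : derivable (a \*: 'D_(gamma v) (energy F)) z (gamma t) by exact: derivableZ.
have d2 : derivable (b \*: 'D_(gamma w) (energy F)) z (gamma t) by exact: derivableZ.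
have e := deriveB d1 d2.
by rewrite (deriveZ a (dE v)) (deriveZ b (dE w)) in e.
Qed.

Variables (G : 'rV[R]_(n + n) -> 'rV[R]_(n + n)) (phi : 'rV[R]_(n + n) -> 'rV[R]_n)
  (Dc : connection R n).
Hypothesis sG : smooth O G.
Hypothesis JG : forall z, O z -> Jend (G z) = liouville z.
Hypothesis CG : forall z, O z -> bracket (@liouville R n) G z = G z.
Hypothesis Dc_berwald : berwald O G Dc.
Hypothesis sphi : smooth O phi.
Hypothesis Dc_hor : forall z w, O z -> Dc z (beta G z w) phi = - w.
Hypothesis Dc_ver : forall z w, O z -> Dc z (gamma w) phi = 0.

Let C := @liouville R n.
Let V z := gamma (phi z).
Let H z := hproj G z (row_mx (phi z) 0).

Let sC : smooth O C. Proof. exact: smooth_liouville. Qed.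
Let sV : smooth O V. Proof. exact: smooth_gamma. Qed.
Let sH : smooth O H. Proof. exact: (smooth_hproj_lift Oo sG JG sphi). Qed.
Let dphi_ver z w : O z -> 'D_(gamma w) phi z = 0.
Proof. exact: (concurrent_vertical Oo sG JG Dc_berwald sphi Dc_ver). Qed.
Let dV z v : O z -> 'D_v V z = gamma ('D_v phi z).
Proof. exact: (derive_lift sphi). Qed.
Let dV_ver z w : O z -> 'D_(gamma w) V z = 0.
Proof. by move=> Oz; rewrite dV// dphi_ver// gamma0. Qed.
Let brVG z : O z -> bracket V G z = H z + C z.
Proof.
exact: (bracket_spray_lift Oo sG JG CG Dc_berwald sphi Dc_hor).
Qed.
Let brHV z : O z -> bracket H V z = - V z.
Proof. exact: (bracket_horizontal_lift Oo sG JG Dc_berwald sphi Dc_hor Dc_ver). Qed.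
Let brCV z : O z -> bracket C V z = - V z.
Proof. exact: (bracket_liouville_lift Oo sG JG Dc_berwald sphi Dc_ver). Qed.

(** The left side is the complete lift of [phi] to the tangent bundle. The formula follows from
    [V,G] = H + C, since [hprojE] gives the derivative of G along V as 2H - (phi, 0). *)
Let complete_lift z : O z ->
  'D_(G z) V z + row_mx (phi z) 0 = H z - C z.
Proof.
move=> Oz; have := brVG Oz; rewrite /bracket /H (hprojE Oo sG JG _ Oz) row_mxKl => E.
have -> : C z = 'D_(V z) G z - 'D_(G z) V z - 2^-1 *: (row_mx (phi z) 0 + 'D_(V z) G z).
  by rewrite E addrC addKr.
by apply/rowP => i; rewrite !mxE; field.
Qed.

(** The Euler-Lagrange equation in direction [phi], for a spray value differing from G by a multiple
    of C. It is applied with c = 0 to F and with c = 2P to L. *)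
Let spray_lift E z X c : smooth O E ->
  (forall x, O x -> lie C E x = 2 * E x) -> O z ->
  X = G z - c *: C z -> Jend X = liouville z ->
  (forall Y, dd_J E z X Y = - 'D_Y E z) ->
  'D_X E z = 0 /\ 'D_X (lie V E) z = lie H E z - 2 * E z.
Proof.
move=> sE CE Oz XE JX hX.
have [XE0 XE1] := spray_equations Oo sE CE Oz JX hX; split=> //.
have dE : differentiable E z by exact: smooth_differentiable Oz.
have dVz : differentiable V z by exact: smooth_differentiable Oz.
rewrite (derive_lie Oo X sV sE Oz) /V XE1 -/V.
(* V is constant along fibres, so the vertical correction does not affect its derivative; what
   remains is the complete lift applied to E. *)
have -> : 'D_X V z = 'D_(G z) V z.
  by rewrite XE derive_dirB// derive_dirZ// [X in _ - _ *: X]dV_ver// scaler0 subr0.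
rewrite -derive_dirD// complete_lift// derive_dirB//.
by congr (_ - _); exact: CE.
Qed.

(** * Values of the metric on phi and eta, and the two Euler-Lagrange equations *)

Section Metric.
Variable F : 'rV[R]_(n + n) -> R.
Hypothesis sF : smooth O F.
Hypothesis CF : forall z, O z -> lie C F z = F z.
Let E := energy F.
Let sE : smooth O E. Proof. exact: smooth_energy. Qed.
Let CE z : O z -> lie C E z = 2 * E z.
Proof. by move=> Oz; apply: lie_liouville_energy => //; exact: CF. Qed.

(** Differentiate Euler's relation CE = 2E along gamma w. *)
Lemma metric_eta z w : O z -> metric F z w (eta z) = 'D_(gamma w) E z.
Proof.
move=> Oz; rewrite metricE -/(liouville z).
have h := derive_lie Oo (gamma w) sC sE Oz.
have h2 : 'D_(gamma w) (lie C E) z = 2 * 'D_(gamma w) E z.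
  exact: (lie_onZ Oo (cst (gamma w)) sE CE Oz).
move: h; rewrite h2 derive_liouville row_mxKr -/E -/C.
set a := 'D_(gamma w) E z; set b := 'D_(gamma w) _ z => h.
have gen (r s : R) : 2 * r = r + s -> s = r by lra.
exact: gen.
Qed.

Lemma metric_phi_eta z : O z -> metric F z (phi z) (eta z) = lie V E z.
Proof. exact: metric_eta. Qed.

Lemma metric_eta_eta z : O z -> metric F z (eta z) (eta z) = F z ^+ 2.
Proof.
by move=> Oz; rewrite metric_eta// -[LHS]/(lie C E z) CE// /E /energy; field.
Qed.

(** With [phi] in the second slot the metric is the derivative of VE along C, V being constant on
    fibres, and VE is 1-homogeneous. *)
Lemma metric_eta_phi z : O z -> metric F z (eta z) (phi z) = lie V E z.
Proof.
move=> Oz; rewrite metricE -/(liouville z) -/(V z).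
have h := derive_lie Oo (liouville z) sV sE Oz.
rewrite dV_ver// derive0 add0r in h; rewrite -h.
exact: (lie_liouville_lift Oo sV sC brCV sE CE Oz).
Qed.

Lemma metric_phi_phi z : O z -> metric F z (phi z) (phi z) = lie V (lie V E) z.
Proof.
move=> Oz; rewrite metricE -/(V z).
have h := derive_lie Oo (V z) sV sE Oz.
have e : 'D_(V z) V z = 0 := dV_ver (phi z) Oz.
rewrite e derive0 add0r in h; exact: esym h.
Qed.

(** The vector F^2 phi - Phi eta has squared norm F^2 (F^2 p - Phi^2) = 0, so positive definiteness
    makes it vanish. *)
Lemma metric_cauchy_schwarz_eq z : O z ->
  (forall w, w != 0 -> 0 < metric F z w w) ->
  lie V E z ^+ 2 = F z ^+ 2 * lie V (lie V E) z ->
  F z ^+ 2 *: phi z = lie V E z *: eta z.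
Proof.
move=> Oz pos eqCS; set a := F z ^+ 2; set b := lie V E z.
apply/eqP; rewrite -subr_eq0; apply: contraT => /pos.
rewrite (metric_subZl _ _ _ _ _ sF Oz) !(metric_subZr _ _ _ _ _ sF Oz)
  metric_phi_phi// metric_phi_eta// metric_eta_phi// metric_eta_eta//.
rewrite -/a -/b in eqCS *.
have -> : a * (a * lie V (lie V E) z - b * b) - b * (a * b - b * a) =
    a * (a * lie V (lie V E) z - b ^+ 2) by ring.
by rewrite eqCS subrr mulr0 ltxx.
Qed.

(** Parallelism can be differentiated along the fibre because it holds on an open set. The left side
    then varies only through F^2, as [phi] is independent of y, and comparing two coordinates gives
    F^2 Phi = 0. *)
Lemma phi_not_parallel z : (1 < n)%N -> O z -> phi z != 0 -> F z != 0 ->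
  ~ (forall x, O x -> F x ^+ 2 *: phi x = lie V E x *: eta x).
Proof.
move=> n2 Oz phi0 F0 par.
have F20 : F z ^+ 2 != 0 by rewrite expf_neq0.
have sPhi : smooth O (lie V E) by exact: smooth_lie.
have sphii i := smooth_coord Oo i sphi.
have syi i := smooth_coord Oo i (smooth_eta Oo).
have sF2 := smoothM Oo sF sF.
have parE x i : O x -> F x ^+ 2 * phi x 0 i = lie V E x * eta x 0 i.
  have scE (c : R) (v : 'rV[R]_n) : (c *: v) 0 i = c * v 0 i by rewrite mxE.
  by move=> Ox; rewrite -!scE par.
have key w i : phi z 0 i * 'D_(gamma w) (F * F) z =
    lie V E z * w 0 i + eta z 0 i * 'D_(gamma w) (lie V E) z.
  have h : lie (cst (gamma w)) ((F * F) * (fun x => phi x 0 i)) z =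
      lie (cst (gamma w)) (lie V E * (fun x => eta x 0 i)) z.
    apply: (lie_on Oo) => // x Ox.
    by rewrite [LHS]/= -[LHS]/((F x * F x) * phi x 0 i) -expr2 parE.
  rewrite (lieM _ sF2 (sphii i) Oz) (lieM _ sPhi (syi i) Oz) in h.
  move: h; rewrite /lie derive_coord; last exact: smooth_differentiable Oz.
  rewrite dphi_ver// mxE mulr0 add0r => ->.
  by rewrite derive_coord ?derive_rsubmx_id ?row_mxKr//; exact: differentiable_eta.
have Phi0 : lie V E z != 0.
  apply: contraNneq phi0 => Phi0; have := par z Oz.
  by rewrite Phi0 scale0r => /eqP; rewrite scaler_eq0 (negPf F20).
have /existsP[l yl0] : [exists l, eta z 0 l != 0].
  apply: contraT; rewrite negb_exists => /forallP y0.
  have y00 : eta z = 0.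
    by apply/rowP => l; move: (y0 l); rewrite negbK => /eqP ->; rewrite mxE.
  have := par z Oz; rewrite y00 scaler0 => /eqP.
  by rewrite scaler_eq0 (negPf F20) (negPf phi0).
have /existsP[j jl] : [exists j, j != l].
  apply: contraT; rewrite negb_exists => /forallP jl.
  have : (#|'I_n| <= 1)%N.
    by apply/card_le1_eqP => i k _ _;
      move: (jl i) (jl k); rewrite !negbK => /eqP -> /eqP ->.
  by rewrite card_ord leqNgt n2.
have kl := key (delta_mx 0 j) l; have kj := key (delta_mx 0 j) j.
have pl : F z ^+ 2 * phi z 0 l = lie V E z * eta z 0 l.
  exact: parE.
have pj : F z ^+ 2 * phi z 0 j = lie V E z * eta z 0 j.
  exact: parE.
have dl : (delta_mx 0 j : 'rV[R]_n) 0 l = 0 by rewrite mxE eqxx eq_sym (negPf jl).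
have dj : (delta_mx 0 j : 'rV[R]_n) 0 j = 1 by rewrite mxE !eqxx.
rewrite dl mulr0 add0r in kl; rewrite dj mulr1 in kj.
have := parallel_arith yl0 pl pj kl kj.
by apply/eqP; rewrite mulf_neq0.
Qed.

Hypothesis F0 : forall z, O z -> F z != 0.
Hypothesis spray_E : forall z Y, O z -> dd_J E z (G z) Y = - 'D_Y E z.

Let Phi := lie V E.
Let sPhi : smooth O Phi. Proof. exact: smooth_lie. Qed.
Let p := lie V Phi.
Let sp : smooth O p. Proof. exact: smooth_lie. Qed.

Let spray_lift_E z : O z -> lie G E z = 0 /\ lie G Phi z = lie H E z - 2 * E z.
Proof.
move=> Oz; apply: (spray_lift (c := 0)) => //; last by move=> Y; exact: spray_E.
  by rewrite scale0r subr0.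
exact: JG.
Qed.

Let GE z : O z -> lie G E z = 0. Proof. by move=> /spray_lift_E[]. Qed.

(** G Phi is computed twice: the Euler-Lagrange equation gives HE - 2E, the commutator [V,G] = H + C
    gives -HE - 2E. *)
Let HE z : O z -> lie H E z = 0.
Proof.
have gen (x y : R) : 0 - (x - 2 * y) = x + 2 * y -> x = 0 by lra.
move=> Oz; have dE : differentiable E z by exact: smooth_differentiable Oz.
have := lie_bracket Oo sV sG sE Oz.
rewrite brVG// derive_dirD// (lie_on0 Oo V GE Oz) -/Phi (spray_lift_E Oz).2.
rewrite -[X in _ = X + _]/(lie H E z) -[X in _ = _ + X]/(lie C E z) CE//.
exact: gen.
Qed.

Let GPhi z : O z -> lie G Phi z = - (2 * E z).
Proof. exact: (lie_spray_pairing Oo sG sV sE brVG GE HE CE). Qed.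

Let HPhi z : O z -> lie H Phi z = - Phi z.
Proof. exact: (lie_horizontal_pairing Oo sV sH sE brHV HE). Qed.

Let Gp z : O z -> lie G p z = - (2 * Phi z).
Proof. exact: (lie_spray_norm Oo sG sV sC sH sE brVG brHV brCV GE HE CE). Qed.

Let lie_F_eq0 X z : O z -> lie X E z = 0 -> lie X F z = 0.
Proof.
move=> Oz; rewrite /E lie_energy// => /eqP.
by rewrite mulf_eq0 (negPf (F0 Oz)) => /eqP.
Qed.

(** The defining relation is kept in the form L (F - Phi) = F^2 and differentiated as a product,
    which supplies the hypotheses of [matsumoto_identity] without differentiating a quotient. *)
Lemma matsumoto_projective L z (P : R) X : smooth O L ->
  (forall x, O x -> lie C L x = L x) ->
  (forall x, O x -> L x * (F x - Phi x) = F x ^+ 2) -> O z ->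
  X = G z - (2 * P) *: C z -> Jend X = liouville z ->
  (forall Y, dd_J (energy L) z X Y = - 'D_Y (energy L) z) ->
  Phi z ^+ 2 = F z ^+ 2 * p z.
Proof.
have gen1 (a b c d x y w t : R) :
  a * b + c * d + (x * y + w * t) = c * d + b * a + (w * t + y * x) by ring.
have gen2 (a b : R) : 2 * b * (2 * (2^-1 * a ^+ 2)) = 2 * b * a ^+ 2 by field.
have gen3 (a b : R) : a * b - 2 * (2^-1 * a ^+ 2) = a * b - a ^+ 2 by field.
have gen4 (a b c d q : R) :
  a * b + c * d - 2 * q * (c * b) = c * d + b * a - 2 * q * (c * b) by ring.
move=> sL CL Lu Oz XE JX hX.
pose u := F + (-1) \*: Phi.
have su : smooth O u by apply: smoothD => //; exact: smoothZ.
have uE x : u x = F x - Phi x by rewrite /u -[LHS]/(F x + -1 * Phi x) mulN1r.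
have lie_u Y x : O x -> lie Y u x = lie Y F x - lie Y Phi x.
  move=> Ox; rewrite /u (lieD Y sF (smoothZ Oo (-1) sPhi) Ox).
  by rewrite (lieZ (-1) Y sPhi Ox) mulN1r.
have sVF : smooth O (lie V F) by exact: smooth_lie.
have sVL : smooth O (lie V L) by exact: smooth_lie.
have sVu : smooth O (lie V u) by exact: smooth_lie.
have FVF x : O x -> (F * lie V F) x = Phi x.
  by move=> Ox; rewrite /Phi /E lie_energy.
have LuE x : O x -> (L * u) x = (F * F) x.
  by move=> Ox; rewrite -[LHS]/(L x * u x) uE Lu// expr2.
have lie_Lu Y x : O x -> lie Y L x * u x + L x * lie Y u x = 2 * (F x * lie Y F x).
  move=> Ox; have := lie_on Oo Y LuE Ox.
  rewrite (lieM Y sL su Ox) (lieM Y sF sF Ox) => e.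
  by rewrite [2 * _]mulr_natl mulr2n -e addrC [u x * _]mulrC.
have GF x : O x -> lie G F x = 0 by move=> Ox; apply: lie_F_eq0 => //; exact: GE.
have HF x : O x -> lie H F x = 0 by move=> Ox; apply: lie_F_eq0 => //; exact: HE.
have E2 : 2 * E z = F z ^+ 2 by rewrite /E /energy; field.
have VLu x : O x -> (lie V L * u + L * lie V u) x = 2 * Phi x.
  by move=> Ox; rewrite -[LHS]/(lie V L x * u x + L x * lie V u x) lie_Lu// -FVF.
have sEL := smooth_energy sL.
have CEL x : O x -> lie C (energy L) x = 2 * energy L x.
  by move=> Ox; apply: lie_liouville_energy => //; exact: CL.
have [XE0 XE1] := spray_lift sEL CEL Oz XE JX hX.
have dirX f : smooth O f -> 'D_X f z = lie G f z - 2 * P * lie C f z.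
  move=> sf; have df : differentiable f z by exact: smooth_differentiable Oz.
  by rewrite XE derive_dirB// derive_dirZ.
have GVF : F z * lie G (lie V F) z = lie G Phi z.
  rewrite -(lie_on Oo G FVF Oz) (lieM G sF sVF Oz) GF// mulr0 addr0.
  by [].
apply: (@matsumoto_identity _ (F z) (u z) (L z) (lie V F z) (p z) (lie G L z)
  (lie V L z) (lie G (lie V L) z) (lie H L z) (lie G (lie V F) z) (lie G u z)
  (lie V u z) (lie H u z) (lie G (lie V u) z) (lie G Phi z) (Phi z) P).
- exact: F0.
- exact: uE.
- by rewrite uE Lu.
- exact: FVF.
- by rewrite lie_u.
- by rewrite lie_u// GF// GPhi// sub0r opprK.
- by rewrite lie_u// HF// HPhi// sub0r opprK.
- by rewrite GPhi// E2.
- exact: GVF.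
- have VuE x : O x -> lie V u x = (lie V F + (-1) \*: p) x.
    by move=> Ox; rewrite lie_u// -[RHS]/(lie V F x + -1 * p x) mulN1r.
  rewrite (lie_on Oo G VuE Oz) (lieD G sVF (smoothZ Oo (-1) sp) Oz).
  by rewrite (lieZ (-1) G sp Oz) Gp// mulN1r opprK.
- by rewrite lie_Lu// GF// !mulr0.
- by rewrite lie_Lu// HF// !mulr0.
- exact: VLu.
- have := lie_onZ Oo G sPhi VLu Oz.
  rewrite (lieD G (smoothM Oo sVL su) (smoothM Oo sL sVu) Oz).
  rewrite (lieM G sVL su Oz) (lieM G sL sVu Oz) => <-.
  exact: gen1.
(* Conservation of the energy of L along X = G - 2P C. *)
- have := dirX _ sEL; rewrite XE0 lie_energy// CEL// /energy => /eqP.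
  rewrite eq_sym subr_eq0 => /eqP ->; exact: gen2.
(* The Euler-Lagrange equation of L in direction [phi], expanded through V(L^2/2) = L VL. *)
- have sVEL : smooth O (lie V (energy L)) by exact: smooth_lie.
  have VELE x : O x -> lie V (energy L) x = (L * lie V L) x.
    by move=> Ox; rewrite lie_energy.
  have := dirX _ sVEL; rewrite XE1.
  rewrite (lie_liouville_lift Oo sV sC brCV sEL CEL Oz) (lie_on Oo G VELE Oz).
  rewrite (lieM G sL sVL Oz) VELE// lie_energy// /energy => e.
  by rewrite -gen3 e; exact: gen4.
Qed.

End Metric.
End Chart.

(** * Restriction to one chart and contradiction at a point of the domain *)

Theorem theorem3p2 (R : realType) (n : nat) (n_ge2 : (2 <= n)%N)
    (M : topologicalType) (M_hausdorff : hausdorff_space M)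
    (M_paracompact : paracompact M) (A : atlas R n M)
    (F : idx A -> 'rV[R]_(n + n) -> R)
    (F_finsler : finsler F)
    (G : idx A -> 'rV[R]_(n + n) -> 'rV[R]_(n + n))
    (G_spray : geodesic_spray (@slit_bundle R n M A) F G)
    (nabla Dc : idx A -> connection R n)
    (nabla_cartan : forall a, cartan (slit_bundle a) (F a) (G a) (nabla a))
    (Dc_berwald : forall a, berwald (slit_bundle a) (G a) (Dc a))
    (phi : idx A -> 'rV[R]_(n + n) -> 'rV[R]_n)
    (phi_concurrent : concurrent G nabla Dc phi)
    (Fh_conic : conic_pseudo_finsler (matsumoto_domain F phi) (matsumoto F phi))
    (nondeg : forall a z, matsumoto_domain F phi a z ->
       F a z * (1 + 2 * p2 F phi a z) - 3 * Phi F phi a z != 0)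
    (Gh : idx A -> 'rV[R]_(n + n) -> 'rV[R]_(n + n))
    (Gh_spray : geodesic_spray (matsumoto_domain F phi) (matsumoto F phi) Gh) :
  ~ projectively_related (matsumoto_domain F phi) G Gh.
Proof.
move=> [P [_ _ GhE]].
(* Non-emptiness of the conic domain provides the chart [a] and the point [z0] at which parallelism
   will fail. *)
have [[_ _ [a [z0 Dz0]] Dopen _] _ _ sL [Lhom _]] := Fh_conic.
have Dslit z : matsumoto_domain F phi a z -> slit_bundle a z by case.
have Dtan z : slit_bundle a z -> tangent_bundle a z by case.
set O := matsumoto_domain F phi a in Dslit Dz0 *.
have Oo : open O by exact: Dopen.
have [_ _ _ sFs [Fhom _ Fpos]] := F_finsler.
have smooth_sub (V : normedModType R) (f : _ -> V) :
    smooth (slit_bundle a) f -> smooth O f.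
  by move=> sf; apply: smooth_subset sf.
have sF : smooth O (F a) by exact: smooth_sub.
have [[sGs _] Gspray] := G_spray.
have sG : smooth O (G a) by exact: smooth_sub.
have JG z : O z -> Jend (G a z) = liouville z by move=> /Dslit /(Gspray a z)[].
have CG z : O z -> bracket (@liouville R n) (G a) z = G a z.
  by move=> /Dslit /(Gspray a z)[].
have EG z Y : O z -> dd_J (energy (F a)) z (G a z) Y = - 'D_Y (energy (F a)) z.
  by move=> /Dslit /(Gspray a z)[].
have [[sphis _] phi0 conc] := phi_concurrent.
have sphi : smooth O (phi a) by exact: smooth_sub.
have Dc_O : berwald O (G a) (Dc a).
  by move=> U Uo UO; apply: Dc_berwald => // z /UO /Dslit.
have Dc_hor z w : O z -> Dc a z (beta (G a) z w) (phi a) = - w.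
  by move=> /Dslit /(conc a z w)[].
have Dc_ver z w : O z -> Dc a z (gamma w) (phi a) = 0.
  by move=> /Dslit /(conc a z w)[].
have CF z : O z -> lie (@liouville R n) (F a) z = F a z.
  by move=> /Dslit /Dtan tz; apply: derive_homogeneous => t; exact: Fhom.
have CL z : O z ->
    lie (@liouville R n) (matsumoto F phi a) z = matsumoto F phi a z.
  by move=> Oz; apply: derive_homogeneous => t; exact: Lhom.
(* F^2 = g(eta, eta) is positive off the zero section. *)
have F0 z : O z -> F a z != 0.
  move=> Oz; have := Fpos a z (eta z) (Dslit z Oz) (Dslit z Oz).2.
  rewrite (metric_eta_eta Oo sF CF Oz).
  by apply: contraTneq => ->; rewrite expr0n ltxx.
have PhiE z : O z -> Phi F phi a z = lie (fun x => gamma (phi a x)) (energy (F a)) z.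
  by move=> Oz; exact: (metric_phi_eta Oo (phi a) sF CF Oz).
have Lu z : O z -> matsumoto F phi a z *
    (F a z - lie (fun x => gamma (phi a x)) (energy (F a)) z) = F a z ^+ 2.
  move=> Oz; rewrite -PhiE// /matsumoto mulfVK// subr_eq0 eq_sym.
  by have [_ /lt_eqF ->] := Oz.
apply: (phi_not_parallel Oo sG JG Dc_O sphi Dc_ver sF n_ge2 Dz0).
- exact: phi0 (Dslit _ Dz0).
- exact: F0.
(* It remains to show F^2 phi = Phi eta at every point of [O], through the equality case of
   Cauchy-Schwarz. *)
move=> z Oz.
apply: (metric_cauchy_schwarz_eq Oo sG JG Dc_O sphi Dc_ver sF CF Oz).
  by move=> w; apply: Fpos; exact: Dslit.
have [_ /(_ a z Oz)[Jh _ Eh]] := Gh_spray.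
exact: (matsumoto_projective Oo sG JG CG Dc_O sphi Dc_hor Dc_ver sF CF F0 EG
  (sL a) CL Lu Oz (GhE a z Oz) Jh Eh).
Qed.
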